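(* Consider a set of $n\times n$ switch systems with a fixed reconfiguration delay $\Delta_r>0$ (an integer number of slots), parametrized by $0<\epsilon<1$, all operated under the Adaptive MaxWeight policy with hysteresis function $g$, where $g$ is increasing, sublinear ($g(x)/x\to 0$ as $x\to\infty$) and concave. The system with parameter $\epsilon$ has an arrival process $\mathbf{a}^{(\epsilon)}(t)$ that is i.i.d. over time slots, independent across queues, takes values in $\{0,1,2,\dots\}$ and satisfies $a^{(\epsilon)}_{ij}(t)\le a_{\max}<\infty$. Its mean is $\boldsymbol{\lambda}^{(\epsilon)}=(1-\epsilon)\boldsymbol{\nu}$ for some fixed $\boldsymbol{\nu}\in\mathcal{F}$ such that $\nu_{\min}:=\min_{i,j}\nu_{ij}>0$, and its entrywise variances $(\sigma^{(\epsilon)}_{ij})^2$ satisfy $\|\boldsymbol{\sigma}^{(\epsilon)}\|^2\le\tilde\sigma^2$ for some $\tilde\sigma^2$ not dependent on $\epsilon$. Let $\mathbf{X}^{(\epsilon)}(t)=(\mathbf{q}^{(\epsilon)}(t),\mathbf{s}^{(\epsilon)}(t),r^{(\epsilon)}(t))$ be the Markov chain describing the system, which is positive recurrent and hence converges in distribution to a steady-state random vector $\bar{\mathbf{X}}^{(\epsilon)}=(\bar{\mathbf{q}}^{(\epsilon)},\bar{\mathbf{s}}^{(\epsilon)},\bar r^{(\epsilon)})$. Then for any fixed $\theta$ with $0<\theta<1/2$, and for each system with $0<\epsilon\le \frac{\nu_{\min}}{4\|\boldsymbol{\nu}\|}$, the steady-state queue length vector satisfies $$\mathbb{E}\Big[\|\bar{\mathbf{q}}^{(\epsilon)}_{\perp}\|-\theta\,\|\bar{\mathbf{q}}^{(\epsilon)}_{\parallel}\|\Big]\le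 M_\theta ,$$ where $M_\theta$ is a function of $\theta,\tilde\sigma,a_{\max},\nu_{\min}$ and $n$, but is independent of $\epsilon$.
   Context: **Switch model.** Time is slotted, $t=0,1,2,\dots$. An $n\times n$ input-queued switch has $n^2$ queues $(i,j)$, $1\le i,j\le n$; $q_{ij}(t)$ is the number of packets in queue $(i,j)$ at the beginning of slot $t$, and $a_{ij}(t)$ is the number of packets arriving there in slot $t$. Matrices in $\mathbb{R}^{n\times n}$ are identified with vectors in $\mathbb{R}^{n^2}$, with Euclidean inner product and norm $\|\cdot\|$. The set of feasible schedules is $\mathcal{S}=\{\mathbf{s}\in\{0,1\}^{n\times n}:\ \sum_i s_{ij}\le 1\ \forall j,\ \sum_j s_{ij}\le 1\ \forall i\}$, and $\mathbf{s}(t)\in\mathcal{S}$ is the schedule in slot $t$. **Reconfiguration delay.** Let $t_0^S<t_1^S<\cdots$ be the times at which the schedule is reconfigured; the schedule is constant on each $[t_k^S,t_{k+1}^S-1]$. The remaining reconfiguration time is $r(t)=\Delta_r-(t-t_k^S)$ for $t\in[t_k^S,t_k^S+\Delta_r]$ (where $t_k^S$ is the most recent reconfiguration time) and $r(t)=0$ otherwise. No queue is served while $r(t)>0$. The queue dynamics are $$q_{ij}(t+1)=\max\{q_{ij}(t)+a_{ij}(t)-s_{ij}(t)\mathbf{1}_{\{r(t)=0\}},\,0\}.$$ **Adaptive MaxWeight policy with hysteresis function $g$.** At each $t$, let $\mathbf{s}^*(t)\in\arg\max_{\mathbf{s}\in\mathcal{S}}\sum_{ij}q_{ij}(t)s_{ij}$,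 $W^*(t)=\max_{\mathbf{s}\in\mathcal{S}}\sum_{ij}q_{ij}(t)s_{ij}$, and $W(t)=\sum_{ij}q_{ij}(t)s_{ij}(t)$. If $W^*(t)-W(t)>g(W^*(t))$, then the schedule is reconfigured: $\mathbf{s}(t+1)=\mathbf{s}^*(t)$ and $t+1$ is a reconfiguration time. Otherwise $\mathbf{s}(t+1)=\mathbf{s}(t)$. Then $\mathbf{X}(t)=(\mathbf{q}(t),\mathbf{s}(t),r(t))$ is a discrete-time Markov chain. It is a known background fact that it is positive recurrent for the arrival rates considered here. **Critical rates.** $\mathcal{F}=\{\boldsymbol{\lambda}\in\mathbb{R}^{n\times n}:\ \sum_i\lambda_{ij}=1\ \forall j,\ \sum_j\lambda_{ij}=1\ \forall i\}$. **Cone and projections.** Let $\mathbf{e}^{(i)}$ be the $n\times n$ matrix whose $i$-th row is all ones and whose other entries are zero, and $\tilde{\mathbf{e}}^{(j)}$ the matrix whose $j$-th column is all ones and whose other entries are zero. Let $$\mathcal{K}=\Big\{\sum_i w_i\mathbf{e}^{(i)}+\sum_j\tilde w_j\tilde{\mathbf{e}}^{(j)}:\ w_i,\tilde w_j\ge 0\Big\}.$$ For $\mathbf{x}\in\mathbb{R}^{n^2}$, $\mathbf{x}_\parallel=\arg\min_{\mathbf{y}\in\mathcal{K}}\|\mathbf{x}-\mathbf{y}\|$ and $\mathbf{x}_\perp=\mathbf{x}-\mathbf{x}_\parallel$. *)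

(* Defs.v *)
From HB Require Import structures.
From mathcomp Require Import all_boot all_order all_algebra.
From mathcomp Require Import all_classical all_reals all_analysis.
Set Implicit Arguments.
Unset Strict Implicit.
Unset Printing Implicit Defensive.
Import Order.TTheory GRing.Theory Num.Theory.
Import numFieldNormedType.Exports.
Local Open Scope classical_set_scope.
Local Open Scope ring_scope.

Section Geometry.
Context {R : realType}.

(* Euclidean norm; the norm `|A| of the library is the sup norm. *)
Definition enorm n (A : 'M[R]_n) : R :=
  Num.sqrt (\sum_(i < n) \sum_(j < n) A i j ^+ 2).

Definition min_entry n (A : 'M[R]_n.+1) : R :=
  \big[Order.min/A ord0 ord0]_(i < n.+1)
    \big[Order.min/A ord0 ord0]_(j < n.+1) A i j.

Definition critical_rates n : set 'M[R]_n :=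
  [set l | (forall j, \sum_i l i j = 1) /\ (forall i, \sum_j l i j = 1)].

Definition row_ones n (i : 'I_n) : 'M[R]_n := \matrix_(k, l) (k == i)%:R.
Definition col_ones n (j : 'I_n) : 'M[R]_n := \matrix_(k, l) (l == j)%:R.

Definition cone n : set 'M[R]_n :=
  [set x | exists w w' : 'I_n -> R,
     [/\ forall i, 0 <= w i, forall j, 0 <= w' j
       & x = \sum_i w i *: row_ones i + \sum_j w' j *: col_ones j]].

(* The minimizer exists and is unique, the cone being closed and convex, so the
   default value 0 of xget is never used. *)
Definition cone_par n (x : 'M[R]_n) : 'M[R]_n :=
  xget 0 [set y | cone y /\
                  forall z, cone z -> enorm (x - y) <= enorm (x - z)].

Definition cone_perp n (x : 'M[R]_n) : 'M[R]_n := x - cone_par x.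

Definition real_mx n (q : 'M[nat]_n) : 'M[R]_n := map_mx (fun k => k%:R) q.

End Geometry.

(* All random elements below take values in countable types carrying the
   discrete sigma-algebra. *)
Section DiscreteProbability.
Context {R : realType} {d : measure_display} {Omega : measurableType d}.
Context (P : probability Omega R).

Definition discrete_rv (T : Type) (Y : Omega -> T) :=
  forall B : set T, measurable (Y @^-1` B).

Definition mutually_independent (I : choiceType) (T : Type)
    (Y : I -> Omega -> T) :=
  forall (J : seq I) (B : I -> set T), uniq J ->
    P [set w | forall k, k \in J -> B k (Y k w)] =
    (\prod_(k <- J) P (Y k @^-1` B k))%E.

Definition path_event (T : Type) (Y : nat -> Omega -> T) (t : nat)
    (y : nat -> T) : set Omega :=
  [set w | forall k, (k <= t)%N -> Y k w = y k].

Definition independent_of_past (A T : Type) (a : Omega -> A)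
    (Y : nat -> Omega -> T) (t : nat) :=
  forall (B : set A) (y : nat -> T),
    P (a @^-1` B `&` path_event Y t y) =
    (P (a @^-1` B) * P (path_event Y t y))%E.

Definition markov_chain (T : choiceType) (X : nat -> Omega -> T) :=
  exists p : T -> T -> R,
    [/\ forall x y, 0 <= p x y,
        forall x, (\esum_(y in [set: T]) (p x y)%:E = 1)%E
      & forall (t : nat) (x : nat -> T),
          P (path_event X t.+1 x) =
          (P (path_event X t x) * (p (x t) (x t.+1))%:E)%E].

End DiscreteProbability.

(* For the discrete topology on T every function is continuous, hence the test
   functions are all bounded functions. *)
Definition cvg_in_distribution (R : realType) (T : Type)
    (d : measure_display) (Omega : measurableType d) (P : probability Omega R)
    (X : nat -> Omega -> T)
    (d' : measure_display) (Omega' : measurableType d')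
    (P' : probability Omega' R) (Y : Omega' -> T) :=
  forall f : T -> R, (exists C : R, forall x, `|f x| <= C) ->
    ('E_P[f \o X t])%E @[t --> \oo] --> ('E_P'[f \o Y])%E.

Record random_element (R : realType) (T : Type) := RandomElement {
  re_disp : measure_display;
  re_space : measurableType re_disp;
  re_prob : probability re_space R;
  re_val : re_space -> T;
  re_meas : discrete_rv re_val }.

Section Switch.
Context (n : nat).

(* The entries 0 and 1 of a schedule are false and true. *)
Definition feasible (s : 'M[bool]_n) : bool :=
  [forall j, (\sum_(i < n) s i j <= 1)%N] &&
  [forall i, (\sum_(j < n) s i j <= 1)%N].

Definition weight (q : 'M[nat]_n) (s : 'M[bool]_n) : nat :=
  (\sum_(i < n) \sum_(j < n) q i j * s i j)%N.

Definition max_weight (q : 'M[nat]_n) : nat :=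
  (\max_(s | feasible s) weight q s)%N.

(* (queue lengths, schedule, remaining reconfiguration time) *)
Definition state : Type := ('M[nat]_n * 'M[bool]_n * nat)%type.

(* swp_opt is the schedule s*(t) and swp_reconf t holds when t is one of the
   reconfiguration times t_k^S. *)
Record switch_process (R : realType) := SwitchProcess {
  swp_disp : measure_display;
  swp_space : measurableType swp_disp;
  swp_prob : probability swp_space R;
  swp_arr : nat -> swp_space -> 'M[nat]_n;
  swp_queue : nat -> swp_space -> 'M[nat]_n;
  swp_sched : nat -> swp_space -> 'M[bool]_n;
  swp_opt : nat -> swp_space -> 'M[bool]_n;
  swp_reconf : nat -> swp_space -> bool;
  swp_remain : nat -> swp_space -> nat }.

Section SystemLaws.
Context {R : realType}.
Context (S : switch_process R).

Local Notation P := (@swp_prob R S).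
Local Notation a := (@swp_arr R S).
Local Notation q := (@swp_queue R S).
Local Notation s := (@swp_sched R S).
Local Notation sopt := (@swp_opt R S).
Local Notation reconf := (@swp_reconf R S).
Local Notation r := (@swp_remain R S).

Definition swp_state (t : nat) (w : swp_space S) : state :=
  (q t w, s t w, r t w).

Definition swp_measurable :=
  forall t, [/\ discrete_rv (a t), discrete_rv (swp_state t)
              & discrete_rv (sopt t)].

(* Natural-number subtraction is truncated at 0. *)
Definition queue_dynamics :=
  forall t w i j,
    q t.+1 w i j = (q t w i j + a t w i j - s t w i j * (r t w == 0))%N.

(* Before the first reconfiguration time the remaining time is 0; subtraction
   is truncated, which gives 0 once Dr slots have elapsed. *)
Definition reconfiguration_delay (Dr : nat) :=
  forall t w,
    (forall k, (k <= t)%N -> reconf k w ->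
       (forall k', (k < k' <= t)%N -> ~~ reconf k' w) ->
       r t w = (Dr - (t - k))%N) /\
    ((forall k, (k <= t)%N -> ~~ reconf k w) -> r t w = 0%N).

(* The choice of s*(t) among the maximizers is left free, possibly random,
   subject to markov_switch below. *)
Definition adaptive_maxweight (g : R -> R) :=
  (forall w, feasible (s 0%N w)) /\
  forall t w,
    [/\ feasible (sopt t w),
        weight (q t w) (sopt t w) = max_weight (q t w),
        reconf t.+1 w =
          (g (max_weight (q t w))%:R <
           (max_weight (q t w))%:R - (weight (q t w) (s t w))%:R)
      & s t.+1 w = if reconf t.+1 w then sopt t w else s t w].

(* Arrivals of slot t are independent of all that has been decided by the
   beginning of slot t, s*(t) included. *)
Definition markov_switch :=
  (forall t, independent_of_past P (a t)
               (fun k w => (swp_state k w, sopt k w)) t) /\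
  markov_chain P swp_state.

Definition is_switch_system (Dr : nat) (g : R -> R) :=
  [/\ swp_measurable, queue_dynamics, reconfiguration_delay Dr,
      adaptive_maxweight g & markov_switch].

Definition arrival_entry (t : nat) (i j : 'I_n) (w : swp_space S) : R :=
  (a t w i j)%:R.

Definition iid_arrivals :=
  mutually_independent P
    (fun (k : nat * ('I_n * 'I_n)) w => a k.1 w k.2.1 k.2.2) /\
  forall t (B : set 'M[nat]_n), P (a t @^-1` B) = P (a 0%N @^-1` B).

Definition bounded_arrivals (amax : R) :=
  forall t w i j, arrival_entry t i j w <= amax.

Definition mean_arrivals (l : 'M[R]_n) :=
  forall t i j, ('E_P[arrival_entry t i j] = (l i j)%:E)%E.

Definition std_arrivals (sigma : 'M[R]_n) :=
  forall t i j, 0 <= sigma i j /\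
    variance P (arrival_entry t i j) = (sigma i j ^+ 2)%:E.

Definition steady_state (X : random_element R state) :=
  cvg_in_distribution P swp_state (re_prob X) (@re_val R state X).

End SystemLaws.
End Switch.

Definition steady_queue (R : realType) (n : nat)
    (X : random_element R (state n)) (w : re_space X) : 'M[R]_n :=
  real_mx (re_val w).1.1.

(* Main.v *)
(* Write W* for the maximal weight, W for the weight of the current schedule,
   Q for the total backlog and r for the remaining reconfiguration time.  Since
   nu + nu_min q_perp / |q_perp| is doubly substochastic, Birkhoff's theorem
   gives W* >= <q, nu> + nu_min |q_perp|, so |q|^2 has a drift of at most
   -2 nu_min |q_perp| - 2 eps nu_min Q, up to a small multiple of Q due to the
   hysteresis and to the term 2 Q 1_{r > 0} due to the delay.  The latter is
   absorbed by adding 2 Q (r + Delta_r min(1, (W* - W) / L)) to |q|^2: during a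
   delay this term decreases by 2 Q per slot, while the jump of r at a
   reconfiguration is paid for by the collapse of the gap W* - W.  A first use
   of the resulting drift inequality, with constants depending on eps, gives
   E[Q] < oo; a second one, with constants independent of eps, gives the bound.

   The compensation requires reconfigurations at large backlog to be preceded by
   a large gap.  This holds when g is unbounded, and also for n = 1 when g is
   somewhere nonnegative.  In the remaining cases the system has no steady state
   for small eps, because delays cost more capacity than the slack eps. *)

Require Import Defs.
From HB Require Import structures.
From mathcomp Require Import all_boot all_order all_algebra.
From mathcomp Require Import all_classical all_reals all_analysis.
From mathcomp Require Import measurable_realfun ring lra zify.
Set Implicit Arguments.
Unset Strict Implicit.
Unset Printing Implicit Defensive.
Import Order.TTheory GRing.Theory Num.Theory.
Import numFieldNormedType.Exports.
Local Open Scope ring_scope.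

(** * Matchings and the maximal weight *)

(** The order of quantifiers shapes the proof. [M] is chosen before the systems, so the constant of
    the drift inequality must not depend on [nu], [eps] or the arrival law; [drift_certificate]
    therefore ranges over all rate matrices [lambda] and keeps them in explicit terms only.
    Conversely, a bounded [g] cannot be excluded by looking at the one system for which the bound is
    claimed: the contradiction comes from another member of the family. The steady state is known
    only as a limit in distribution, tested on bounded functions, so the drift is applied to the
    minimum of [Phi] and a level, which is then sent to infinity. The quantity to be bounded has no
    sign, and this last limit needs its integrability; hence the preliminary use of the drift with
    constants depending on eps. In the final use, with N the size of the switch, Q <= N^2 (|q_perp|
    + |q_par|), so the choice kappa = nu_min theta / N^2 turns the error kappa Q into at most nu_min
    theta (|q_perp| + |q_par|). Its first part is absorbed by one half of 2 nu_min |q_perp|, and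
    what remains is C - nu_min (|q_perp| - theta |q_par|). *)

Lemma hall (T U : finType) (u0 : U) (N : T -> {set U}) (A : {set T}) :
  (forall B : {set T}, B \subset A -> (#|B| <= #|(\bigcup_(i in B) N i)%SET|)%N) ->
  exists f : T -> U, {in A, forall i, f i \in N i} /\ {in A &, injective f}.
Proof.
have [m] := ubnP #|A|; elim: m N A => // m IH N A ltAm hallA.
have [->|[a aA]] := finset.set_0Vmem A.
  by exists (fun=> u0); split => [i|i j]; rewrite inE.
(* Dichotomy of Halmos and Vaughan: a proper nonempty tight set [B] is matched inside its
   neighbourhood [NB], and the rest of [A] outside it. If no set is tight, any edge from [a] to [y]
   can be removed, since every remaining nonempty set has a neighbour to spare. *)
case: (pickP [pred B : {set T} | [&& B \proper A, B != finset.set0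
    & #|(\bigcup_(i in B) N i)%SET|%N == #|B|]]) => [B /and3P[BA B0 /eqP cB]|tight].
  have ltBA := proper_card BA.
  have [|C CB|f [fN finj]] := IH N B.
  - exact: leq_trans ltBA _.
  - exact/hallA/(fintype.subset_trans CB)/fintype.proper_sub.
  set NB := (\bigcup_(i in B) N i)%SET in cB.
  have [||h [hN hinj]] := IH (fun i => N i :\: NB) (A :\: B).
  - rewrite cardsD (finset.setIidPr (fintype.proper_sub BA)).
    by rewrite -cards_eq0 -lt0n in B0; lia.
  - move=> C; rewrite finset.subsetD => /andP[CA CB].
    have := hallA (C :|: B).
    rewrite finset.subUset CA fintype.proper_sub // => /(_ isT).
    rewrite cardsU (finset.disjoint_setI0 CB) cards0 subn0 => le1.
    rewrite -(leq_add2r #|B|) (leq_trans le1)// -cB.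
    apply: leq_trans (leq_card_setU _ _); apply: subset_leq_card.
    apply/bigcupsP => i; rewrite inE => /orP[iC|iB].
      apply/fintype.subsetP => u ui; rewrite inE orbC.
      case: (boolP (u \in NB)) => //= uN; apply/finset.bigcupP; exists i => //.
      by rewrite inE uN.
    apply: (fintype.subset_trans _ (finset.subsetUr _ _)).
    exact: (finset.bigcup_sup i).
  exists (fun i => if i \in B then f i else h i); split=> [i iA|i j iA jA].
    case: ifPn => [/fN//|iB].
    by have /hN : i \in A :\: B by [rewrite inE iB]; rewrite inE => /andP[].
  have fB k : k \in B -> f k \in NB.
    by move=> kB; apply/finset.bigcupP; exists k => //; exact: fN.
  have hB k : k \in A -> k \notin B -> h k \notin NB.
    move=> kA kB; have /hN : k \in A :\: B by rewrite inE kB.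
    by rewrite inE => /andP[].
  case: ifPn => iB; case: ifPn => jB.
  - exact: finj.
  - by move=> E; move: (hB _ jA jB); rewrite -E fB.
  - by move=> E; move: (hB _ iA iB); rewrite E fB.
  - by apply: hinj; rewrite inE ?iB ?jB.
have := hallA [set a]; rewrite finset.sub1set aA cards1 big_set1 => /(_ isT).
rewrite card_gt0 => /finset.set0Pn[y yNa].
have [||f [fN finj]] := IH (fun i => N i :\ y) (A :\ a).
- by move: ltAm; rewrite (cardsD1 a) aA.
- move=> C CA.
  have [->|[c cC]] := finset.set_0Vmem C; first by rewrite cards0.
  have CpA : C \proper A.
    apply/properP; split; first exact: (fintype.subset_trans CA (finset.subsetDl _ _)).
    by exists a => //; apply/negP => /(fintype.subsetP CA); rewrite !inE eqxx.
  have := tight C; rewrite /= CpA /=.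
  have -> /= : C != finset.set0 by apply/finset.set0Pn; exists c.
  move=> /negbT neq; have := hallA C (fintype.proper_sub CpA).
  rewrite leq_eqVlt eq_sym (negPf neq) /= => lt.
  rewrite -ltnS (leq_trans lt)//.
  rewrite (cardsD1 y) -add1n leq_add ?leq_b1//; apply: subset_leq_card.
  apply/fintype.subsetP => u; rewrite !inE => /andP[uy /finset.bigcupP[i iC ui]].
  by apply/finset.bigcupP; exists i => //; rewrite !inE uy.
exists (fun i => if i == a then y else f i); split=> [i iA|i j iA jA].
  case: eqP => [->//|/eqP ia].
  by have /fN : i \in A :\ a by [rewrite !inE ia]; rewrite !inE => /andP[].
have fy k : k \in A -> k != a -> f k != y.
  move=> kA ka; have /fN : k \in A :\ a by rewrite !inE ka.
  by rewrite !inE => /andP[].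
case: ifPn => [/eqP->|ia]; case: ifPn => [/eqP->//|ja].
- by move=> E; move: (fy _ jA ja); rewrite -E eqxx.
- by move=> E; move: (fy _ iA ia); rewrite E eqxx.
- by apply: finj; rewrite !inE ?ia ?ja.
Qed.

Definition mdot (R : pzSemiRingType) n (A B : 'M[R]_n) : R :=
  \sum_i \sum_j A i j * B i j.

Lemma weightE (R : realType) n (q : 'M[nat]_n) (s : 'M[bool]_n) :
  (weight q s)%:R = mdot (real_mx q : 'M[R]_n) (\matrix_(i, j) (s i j)%:R).
Proof.
rewrite /weight natr_sum; apply: eq_bigr => i _.
by rewrite natr_sum; apply: eq_bigr => j _; rewrite !mxE natrM.
Qed.

Lemma weight_le_max n (q : 'M[nat]_n) s :
  feasible s -> (weight q s <= max_weight q)%N.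
Proof. by move=> fs; exact: (leq_bigmax_cond s). Qed.

Lemma feasible_inj n (f : 'I_n -> 'I_n) :
  injective f -> feasible (\matrix_(i, j) (f i == j)).
Proof.
move=> injf; apply/andP; split; apply/forallP => j.
  case: (pickP (fun i => f i == j)) => [i0 /eqP fi0|none].
    rewrite (bigD1 i0)//= mxE fi0 eqxx big1// => i ii0; rewrite mxE -fi0.
    by rewrite (inj_eq injf) (negPf ii0).
  by rewrite big1// => i _; rewrite mxE none.
rewrite (bigD1 (f j))//= mxE eqxx big1// => i; rewrite mxE eq_sym.
by move=> /negPf ->.
Qed.

Section DoublyStochastic.
Context {R : realType} {n : nat}.
Implicit Types x : 'M[R]_n.+1.

(** The rows of [B] carry the mass [c * #|B|], all of it in the columns of [NB], which carry only
    [c * #|NB|]; this is Hall's condition. *)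
Lemma positive_diagonal x (c : R) : 0 < c -> (forall i j, 0 <= x i j) ->
  (forall i, \sum_j x i j = c) -> (forall j, \sum_i x i j = c) ->
  exists f, injective f /\ forall i, 0 < x i (f i).
Proof.
move=> c0 x0 xr xc.
have [B _|f [fN finj]] := @hall _ _ (@ord0 n)
    (fun i : 'I_n.+1 => finset (fun j => 0 < x i j)) [set: 'I_n.+1]; last first.
  exists f; split=> [i j|i]; first by apply: finj; rewrite finset.in_setT.
  by have := fN i (finset.in_setT i); rewrite inE.
set NB := (\bigcup_(i in B) _)%SET.
suff : c *+ #|B| <= c *+ #|NB| by rewrite (ler_pMn2l c0).
rewrite -!sumr_const.
have -> : \sum_(i in B) c = \sum_(i in B) \sum_(j in NB) x i j.
  apply: eq_bigr => i iB; rewrite -(xr i) (bigID (mem NB))/= [X in _ + X]big1 ?addr0//.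
  move=> j jNB; apply/eqP; rewrite eq_le x0 andbT leNgt; apply: contra jNB.
  by move=> xij; apply/finset.bigcupP; exists i => //; rewrite inE.
rewrite exchange_big; apply: ler_sum => j _; rewrite -(xc j).
by rewrite [leRHS](bigID (mem B))/= lerDl sumr_ge0.
Qed.

(** Birkhoff's theorem in dual form. A permutation supported on positive entries is subtracted with
    its smallest entry [al] as coefficient: the support shrinks, the line sums drop by [al], and the
    part removed contributes at most [al] times the maximal weight. Induction on the size of the
    support then needs no explicit convex combination. *)
Lemma mdot_le_scaled x (c : R) (q : 'M[nat]_n.+1) : 0 <= c ->
  (forall i j, 0 <= x i j) ->
  (forall i, \sum_j x i j = c) -> (forall j, \sum_i x i j = c) ->
  mdot (real_mx q) x <= c * (max_weight q)%:R.
Proof.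
have [m] := ubnP #|[pred p : 'I_n.+1 * 'I_n.+1 | x p.1 p.2 != 0]|.
elim: m x c => // m IH x c ltm c0 x0 xr xc.
move: c0; rewrite le_eqVlt => /predU1P[c0|c0].
  rewrite -c0 mul0r /mdot big1// => i _; rewrite big1// => j _.
  have /psumr_eq0P : \sum_j x i j = 0 by rewrite xr.
  by move=> /(_ (fun j _ => x0 i j)) ->//; rewrite mulr0.
have [f [finj fpos]] := positive_diagonal c0 x0 xr xc.
case: (@Order.TotalTheory.arg_minP _ _ _ (@ord0 n) predT (fun i => x i (f i)) isT).
move=> i0 _ mini; set al := x i0 (f i0) in mini.
have al0 : 0 < al by exact: fpos.
pose y := \matrix_(i, j) (x i j - al * (f i == j)%:R).
have yE i j : y i j = x i j - al * (f i == j)%:R by rewrite mxE.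
have fsum i : \sum_j (f i == j)%:R = 1 :> R.
  rewrite (bigD1 (f i))//= eqxx big1 ?addr0// => j; rewrite eq_sym.
  by move=> /negPf ->.
have fsum' j : \sum_i (f i == j)%:R = 1 :> R.
  have [h fh hf] := injF_bij finj.
  rewrite (bigD1 (h j))//= hf eqxx big1 ?addr0// => i ij.
  by rewrite -(hf j) (inj_eq finj) (negPf ij).
have y0 i j : 0 <= y i j.
  rewrite yE; case: eqP => [<-|_]; last by rewrite mulr0 subr0.
  by rewrite mulr1 subr_ge0 mini.
have alc : al <= c by rewrite -(xr i0) (bigD1 (f i0))//= lerDl sumr_ge0.
have := IH y (c - al).
rewrite subr_ge0 alc => /(_ _ isT y0) IHy.
have {}IHy : mdot (real_mx q) y <= (c - al) * (max_weight q)%:R.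
  apply: IHy.
  - move: ltm; rewrite ltnS; apply: leq_trans; apply: proper_card.
    apply/properP; split.
      apply/fintype.subsetP => -[i j]; rewrite !inE /= yE; apply: contraNneq => xij.
      apply/eqP; rewrite xij sub0r; case: eqP => [E|_]; last by rewrite mulr0 oppr0.
      by have := fpos i; rewrite E xij ltxx.
    exists (i0, f i0); rewrite !inE /= ?(gt_eqF al0)//.
    by rewrite yE eqxx mulr1 subrr eqxx.
  - by move=> i; under eq_bigr do rewrite yE; rewrite sumrB xr -mulr_sumr fsum mulr1.
  - by move=> j; under eq_bigr do rewrite yE; rewrite sumrB xc -mulr_sumr fsum' mulr1.
have -> : mdot (real_mx q) x = mdot (real_mx q) y
    + al * (weight q (\matrix_(i, j) (f i == j)))%:R.
  rewrite weightE /mdot mulr_sumr -big_split; apply: eq_bigr => i _ /=.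
  rewrite mulr_sumr -big_split; apply: eq_bigr => j _ /=.
  by rewrite yE !mxE; ring.
have := weight_le_max q (feasible_inj finj).
rewrite -(ler_nat R) => /(ler_wpM2l (ltW al0)) h.
by rewrite (le_trans (lerD IHy h))// -mulrDl subrK.
Qed.

(** A doubly substochastic matrix lies below a doubly stochastic one: the row deficits [r] and the
    column deficits [c] have the same total [D], and adding [r i * c j / D] fills both. *)
Lemma mdot_le_max_weight x (q : 'M[nat]_n.+1) : (forall i j, 0 <= x i j) ->
  (forall i, \sum_j x i j <= 1) -> (forall j, \sum_i x i j <= 1) ->
  mdot (real_mx q) x <= (max_weight q)%:R.
Proof.
move=> x0 xr xc.
pose r i := 1 - \sum_j x i j; pose c j := 1 - \sum_i x i j.
have r0 i : 0 <= r i by rewrite subr_ge0.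
have c0 i : 0 <= c i by rewrite subr_ge0.
pose D := \sum_i r i.
have Dc : \sum_j c j = D by rewrite /D /r /c !sumrB; congr (_ - _); exact: exchange_big.
have D0 : 0 <= D by exact: sumr_ge0.
pose y := \matrix_(i, j) (x i j + r i * c j / D).
(* If [D = 0] all deficits vanish, so the convention for division by 0 gives the right value. *)
have rD i : r i * D / D = r i.
  have [D0'|D0'] := eqVneq D 0; last by rewrite mulfK.
  have /psumr_eq0P : D = 0 by [].
  by move=> /(_ (fun j _ => r0 j)) ->//; rewrite !mul0r.
have cD i : D * c i / D = c i.
  have [D0'|D0'] := eqVneq D 0; last by rewrite mulrC mulKf.
  move: D0'; rewrite -Dc => /psumr_eq0P.
  by move=> /(_ (fun j _ => c0 j)) ->//; rewrite mulr0 mul0r.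
have xy i j : x i j <= y i j by rewrite mxE lerDl divr_ge0// mulr_ge0.
apply: (@le_trans _ _ (mdot (real_mx q) y)).
  apply: ler_sum => i _; apply: ler_sum => j _.
  by rewrite ler_wpM2l// mxE.
rewrite -[leRHS]mul1r; apply: mdot_le_scaled => //.
- by move=> i j; rewrite (le_trans (x0 i j)).
- move=> i; under eq_bigr do rewrite mxE.
  by rewrite big_split/= -mulr_suml -mulr_sumr Dc rD /r addrC subrK.
- move=> i; under eq_bigr do rewrite mxE.
  by rewrite big_split/= -mulr_suml -mulr_suml -/D cD /c addrC subrK.
Qed.

End DoublyStochastic.

Local Open Scope classical_set_scope.
Local Open Scope ring_scope.

(** * Projection onto the cone *)

Section EuclideanNorm.
Context {R : realType} {n : nat}.
Implicit Types A B C x y z : 'M[R]_n.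

Lemma mdotC A B : mdot A B = mdot B A.
Proof. by apply: eq_bigr => i _; apply: eq_bigr => j _; rewrite mulrC. Qed.

Lemma mdotDl A B C : mdot (A + B) C = mdot A C + mdot B C.
Proof.
rewrite /mdot -big_split; apply: eq_bigr => i _; rewrite -big_split.
by apply: eq_bigr => j _ /=; rewrite mxE mulrDl.
Qed.

Lemma mdotZl (c : R) A B : mdot (c *: A) B = c * mdot A B.
Proof.
rewrite /mdot mulr_sumr; apply: eq_bigr => i _; rewrite mulr_sumr.
by apply: eq_bigr => j _; rewrite mxE mulrA.
Qed.

Lemma mdotNl A B : mdot (- A) B = - mdot A B.
Proof. by rewrite -scaleN1r mdotZl mulN1r. Qed.

Lemma mdotBl A B C : mdot (A - B) C = mdot A C - mdot B C.
Proof. by rewrite mdotDl mdotNl. Qed.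

Lemma mdotDr A B C : mdot A (B + C) = mdot A B + mdot A C.
Proof. by rewrite mdotC mdotDl !(mdotC A). Qed.

Lemma mdotZr (c : R) A B : mdot A (c *: B) = c * mdot A B.
Proof. by rewrite mdotC mdotZl mdotC. Qed.

Lemma mdot_ge0 A B : (forall i j, 0 <= A i j) -> (forall i j, 0 <= B i j) ->
  0 <= mdot A B.
Proof. by move=> A0 B0; do 2! apply: sumr_ge0 => ? _; rewrite mulr_ge0. Qed.

Lemma enormE A : enorm A = Num.sqrt (mdot A A).
Proof. by rewrite /enorm; congr Num.sqrt. Qed.

Lemma mdotAA_ge0 A : 0 <= mdot A A.
Proof. by do 2! apply: sumr_ge0 => ? _; rewrite -expr2 sqr_ge0. Qed.

Lemma enorm_ge0 A : 0 <= enorm A.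
Proof. exact: sqrtr_ge0. Qed.

Lemma enorm_sq A : enorm A ^+ 2 = mdot A A.
Proof. by rewrite enormE sqr_sqrtr// mdotAA_ge0. Qed.

Lemma enorm_le A B : (enorm A <= enorm B) = (mdot A A <= mdot B B).
Proof. by rewrite !enormE ler_sqrt// mdotAA_ge0. Qed.

Lemma sqr_entry_le A i j : A i j ^+ 2 <= mdot A A.
Proof.
rewrite /mdot (bigD1 i)//= (bigD1 j)//= -expr2 -addrA lerDl addr_ge0//.
  by apply: sumr_ge0 => k _; rewrite -expr2 sqr_ge0.
by do 2! apply: sumr_ge0 => ? _; rewrite -expr2 sqr_ge0.
Qed.

Lemma entry_le_enorm A i j : `|A i j| <= enorm A.
Proof. by rewrite -sqrtr_sqr enormE ler_sqrt ?mdotAA_ge0// sqr_entry_le. Qed.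

Lemma sum_le_enorm A : \sum_i \sum_j A i j <= (n * n)%:R * enorm A.
Proof.
apply: (@le_trans _ _ (\sum_(i < n) \sum_(j < n) enorm A)).
  do 2! apply: ler_sum => ? _.
  exact: le_trans (ler_norm _) (entry_le_enorm _ _ _).
by rewrite !sumr_const !card_ord -mulrnA mulr_natl.
Qed.

Lemma enorm_le_sum A : (forall i j, 0 <= A i j) ->
  enorm A <= \sum_i \sum_j A i j.
Proof.
move=> A0.
have S0 : 0 <= \sum_i \sum_j A i j by do 2! apply: sumr_ge0 => ? _.
rewrite -(@ler_pXn2r _ 2%N)// ?nnegrE ?enorm_ge0// enorm_sq.
rewrite expr2 /mdot mulr_suml; apply: ler_sum => i _.
rewrite mulr_suml; apply: ler_sum => j _; rewrite ler_wpM2l//.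
rewrite (bigD1 i)//= (bigD1 j)//= -addrA lerDl addr_ge0//.
  by apply: sumr_ge0.
by do 2! apply: sumr_ge0 => ? _.
Qed.

End EuclideanNorm.

Section ConeProjection.
Context {R : realType} {n : nat}.
Implicit Types x y z : 'M[R]_n.

Lemma coneP y : cone y <-> exists w w' : 'I_n -> R,
  [/\ forall i, 0 <= w i, forall j, 0 <= w' j & forall i j, y i j = w i + w' j].
Proof.
have E (w w' : 'I_n -> R) k l :
  (\sum_i w i *: row_ones i + \sum_j w' j *: col_ones j) k l = w k + w' l.
  rewrite mxE !summxE; congr (_ + _).
    rewrite (bigD1 k)//= big1 ?addr0 => [|i ik]; rewrite !mxE ?eqxx ?mulr1//.
    by rewrite eq_sym (negPf ik) mulr0.
  rewrite (bigD1 l)//= big1 ?addr0 => [|i ik]; rewrite !mxE ?eqxx ?mulr1//.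
  by rewrite eq_sym (negPf ik) mulr0.
split=> -[w [w' [w0 w'0 yE]]]; exists w, w'; split => //.
  by move=> i j; rewrite yE E.
by apply/matrixP => i j; rewrite E yE.
Qed.

Lemma coneD y z : cone y -> cone z -> cone (y + z).
Proof.
move=> /coneP[w [w' [w0 w'0 E]]] /coneP[v [v' [v0 v'0 F]]]; apply/coneP.
exists (fun i => w i + v i), (fun i => w' i + v' i).
split=> [i|i|i j]; rewrite ?addr_ge0//.
by rewrite mxE E F addrACA.
Qed.

Lemma coneZ (c : R) y : 0 <= c -> cone y -> cone (c *: y).
Proof.
move=> c0 /coneP[w [w' [w0 w'0 E]]]; apply/coneP.
exists (fun i => c * w i), (fun i => c * w' i).
split=> [i|i|i j]; rewrite ?mulr_ge0//.
by rewrite mxE E mulrDr.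
Qed.

Lemma cone_row i : cone (row_ones i : 'M[R]_n).
Proof.
apply/coneP; exists (fun k => (k == i)%:R), (fun=> 0).
by split => // k j; rewrite mxE addr0.
Qed.

Lemma cone_col j : cone (col_ones j : 'M[R]_n).
Proof.
apply/coneP; exists (fun=> 0), (fun k => (k == j)%:R).
by split => // i k; rewrite mxE add0r.
Qed.

(** Compactness in the coefficients, stored as one row vector. They can be confined to
    [[0, 2 * enorm x]]: a larger one at index [k] makes the entry [(k, k)] of [x - z] at least
    [enorm x] in absolute value, so [z] does no better than the apex 0. *)
Lemma cone_projection_exists x : exists y, cone y /\
  forall z, cone z -> enorm (x - y) <= enorm (x - z).
Proof.
pose y (v : 'rV[R]_(n + n)) : 'M[R]_n :=
  \matrix_(i, j) (v ord0 (lshift n i) + v ord0 (rshift n j)).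
pose f v := mdot (x - y v) (x - y v).
pose M := 2 * enorm x.
have M0 : 0 <= M by rewrite mulr_ge0// enorm_ge0.
pose A := [set v : 'rV[R]_(n + n) | forall i, 0 <= v ord0 i <= M].
have cf : continuous f.
  move=> v; apply: (@cvg_big _ _ _ _ _ (@add_continuous R) _ (nbhs v)) => i _.
  apply: (@cvg_big _ _ _ _ _ (@add_continuous R) _ (nbhs v)) => j _.
  suff h : (x - y u) i j @[u --> v] --> (x - y v) i j by exact: (cvgM h h).
  under eq_fun do rewrite !mxE.
  rewrite !mxE.
  apply: (@cvgB _ _ _ (nbhs v)); first exact: (@cst_continuous _ _ (x i j) v).
  by apply: cvgD; exact: coord_continuous.
have A0 : A 0 by move=> i; rewrite /= mxE lexx.
have [||c cA cmin] := @EVT_min_rV R (n + n) f A _ _ (continuous_subspaceT cf).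
- by exists 0.
- have -> : A = [set v | forall i, `[0, M]%classic (v ord0 i)].
    by apply/seteqP; split=> u uA i; have := uA i; rewrite /= in_itv.
  by apply: (@rV_compact R _ (fun=> `[0, M]%classic)) => _; exact: segment_compact.
exists (y c); split.
  apply/coneP; exists (fun i => c ord0 (lshift n i)), (fun i => c ord0 (rshift n i)).
  move: cA; rewrite inE => cA.
  have c0 k : 0 <= c ord0 k by have := cA k => /andP[].
  by split => // i j; rewrite mxE.
move=> z /coneP[w [w' [w0 w'0 zE]]]; rewrite enorm_le.
pose v : 'rV[R]_(n + n) := row_mx (\row_i w i) (\row_j w' j).
have zy : z = y v.
  by apply/matrixP => i j; rewrite zE mxE row_mxEl row_mxEr !mxE.
rewrite zy.
rewrite -!/(f _).
have [vA|vA] := pselect (A v); first by apply: cmin; rewrite inE.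
apply: (@le_trans _ _ (f 0)); first by apply: cmin; rewrite inE.
have -> : f 0 = mdot x x.
  rewrite /f; have -> : y 0 = 0 by apply/matrixP => i j; rewrite !mxE addr0.
  by rewrite subr0.
have [k kM] : exists k, M < w k \/ M < w' k.
  apply: contrapT => /forallNP h; apply: vA => i.
  case: (splitP i) => [k ik|k ik].
    have -> : i = lshift n k by exact: val_inj.
    by rewrite row_mxEl mxE w0/= leNgt; apply/negP => ?; case: (h k); left.
  have -> : i = rshift n k by exact: val_inj.
  by rewrite row_mxEr mxE w'0/= leNgt; apply/negP => ?; case: (h k); right.
apply: le_trans (sqr_entry_le (x - y v) k k).
rewrite -enorm_sq -[leRHS]real_normK ?num_real//.
rewrite ler_pXn2r ?nnegrE ?normr_ge0 ?enorm_ge0//.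
have := entry_le_enorm x k k; rewrite ler_norml => /andP[_ xk].
have -> : (x - y v) k k = x k k - (w k + w' k).
  by rewrite -zy !mxE zE.
have := w0 k; have := w'0 k; have := enorm_ge0 x; move: xk kM; rewrite /M.
move: (x k k) (w k) (w' k) (enorm x) => a b b' e xk kM e0 b0 b'0.
rewrite distrC; apply: le_trans (ler_norm _).
by case: kM => ?; lra.
Qed.

Lemma cone_parP x : cone (cone_par x) /\
  forall z, cone z -> enorm (cone_perp x) <= enorm (x - z).
Proof.
rewrite /cone_perp /cone_par.
case: xgetP => [y _ [cy ymin]|none]; first by split.
by have [y [cy ymin]] := cone_projection_exists x; case: (none y).
Qed.

(** First-order optimality: [cone_par x + t *: z] stays in the cone for [t > 0], and a positive
    product would make a suitable small step decrease the distance. *)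
Lemma mdot_perp_cone x z : cone z -> mdot (cone_perp x) z <= 0.
Proof.
move=> cz; have [cy ymin] := cone_parP x.
have key (t : R) : 0 < t -> 2 * mdot (cone_perp x) z <= t * mdot z z.
  move=> t0; have := ymin _ (coneD cy (coneZ (ltW t0) cz)).
  rewrite opprD addrA -/(cone_perp x) enorm_le -scaleNr.
  move: (cone_perp x) => p.
  rewrite !(mdotDl, mdotDr, mdotZl, mdotZr) (mdotC z p) => h.
  by rewrite -(ler_pM2l t0); lra.
rewrite leNgt; apply/negP => p0.
have [z0|z0] := leP (mdot z z) 0; first by have := key 1 ltr01; lra.
have := key (mdot (cone_perp x) z / mdot z z) (divr_gt0 p0 z0).
by rewrite divfK ?gt_eqF//; lra.
Qed.

(** One inequality is [mdot_perp_cone]; the other comes from shrinking [cone_par x] towards the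
    apex. *)
Lemma mdot_perp_par x : mdot (cone_perp x) (cone_par x) = 0.
Proof.
have [cy ymin] := cone_parP x; apply/eqP; rewrite eq_le mdot_perp_cone//=.
set y := cone_par x in cy *; set p := cone_perp x.
have key (t : R) : 0 < t -> t <= 1 -> - (2 * mdot p y) <= t * mdot y y.
  move=> t0 t1; have cz : cone ((1 - t) *: y) by apply: coneZ => //; rewrite subr_ge0.
  have := ymin _ cz; rewrite -/p.
  have -> : x - (1 - t) *: y = p + t *: y.
    by rewrite /p /cone_perp -/y scalerBl scale1r opprB addrA addrAC.
  move: p => p; rewrite enorm_le !(mdotDl, mdotZl, mdotDr, mdotZr) (mdotC y p) => h.
  by rewrite -(ler_pM2l t0); lra.
rewrite leNgt; apply/negP => p0.
have y0 := mdotAA_ge0 y.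
(* With [- mdot p y] added to the denominator, [t <= 1] and [t * mdot y y <= - mdot p y], which
   contradicts [key]. *)
have t0 : 0 < - mdot p y / (mdot y y - mdot p y) by rewrite divr_gt0//; lra.
have t1 : - mdot p y / (mdot y y - mdot p y) <= 1 by rewrite ler_pdivrMr; lra.
have := key _ t0 t1; rewrite mulrAC ler_pdivlMr; last lra.
move: p0 y0; move: (mdot p y) (mdot y y) => a b; nra.
Qed.

Lemma cone_decomp_sq x :
  enorm x ^+ 2 = enorm (cone_perp x) ^+ 2 + enorm (cone_par x) ^+ 2.
Proof.
have {1}-> : x = cone_perp x + cone_par x by rewrite /cone_perp subrK.
have := mdot_perp_par x; move: (cone_perp x) => p h.
by rewrite !enorm_sq !(mdotDl, mdotDr) (mdotC (cone_par x)) h addr0 add0r.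
Qed.

Lemma mdot_perp x : mdot x (cone_perp x) = enorm (cone_perp x) ^+ 2.
Proof.
have {1}-> : x = cone_perp x + cone_par x by rewrite /cone_perp subrK.
have := mdot_perp_par x; move: (cone_perp x) => p h.
by rewrite mdotDl (mdotC (cone_par x)) h addr0 enorm_sq.
Qed.

Lemma enorm_perp_le x : enorm (cone_perp x) <= enorm x.
Proof.
rewrite -(@ler_pXn2r _ 2%N)// ?nnegrE ?enorm_ge0//.
by rewrite (cone_decomp_sq x) lerDl sqr_ge0.
Qed.

Lemma enorm_par_le x : enorm (cone_par x) <= enorm x.
Proof.
rewrite -(@ler_pXn2r _ 2%N)// ?nnegrE ?enorm_ge0//.
by rewrite (cone_decomp_sq x) lerDr sqr_ge0.
Qed.

Lemma enorm_le_perp_par x :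
  enorm x <= enorm (cone_perp x) + enorm (cone_par x).
Proof.
have p0 := enorm_ge0 (cone_perp x); have q0 := enorm_ge0 (cone_par x).
rewrite -(@ler_pXn2r _ 2%N)// ?nnegrE ?enorm_ge0 ?addr_ge0//.
by rewrite cone_decomp_sq sqrrD addrAC lerDl mulrn_wge0// mulr_ge0.
Qed.

End ConeProjection.

(* Moving nu by nu_min in the direction of q_perp stays within the capacity
   region, because q_perp lies in the polar of the cone. *)
Lemma max_weight_ge_perp (R : realType) n (nu : 'M[R]_n.+1) (m : R)
    (q : 'M[nat]_n.+1) :
  critical_rates nu -> 0 <= m -> (forall i j, m <= nu i j) ->
  mdot (real_mx q) nu + m * enorm (cone_perp (real_mx q : 'M[R]_n.+1)) <=
  (max_weight q)%:R.
Proof.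
move=> [nuc nur] m0 mnu; set p := cone_perp _; set e := enorm p.
have e0 : 0 <= e := enorm_ge0 _.
have c0 : 0 <= m / e by rewrite divr_ge0.
have := @mdot_le_max_weight _ _ (nu + (m / e) *: p) q.
rewrite mdotDr mdotZr mdot_perp -/e.
(* If [e = 0] then [m / e] is 0 by convention: the perturbation of [nu] disappears and both sides
   vanish. *)
have -> : m / e * e ^+ 2 = m * e.
  have [->|ne] := eqVneq e 0; first by rewrite expr2 !mulr0.
  by rewrite expr2 mulrA divfK.
apply.
- move=> i j; rewrite mxE [X in _ + X]mxE.
  have := entry_le_enorm p i j; rewrite -/e ler_norml => /andP[pe _].
  have : m / e * - e <= m / e * p i j by rewrite ler_wpM2l.
  have : m / e * e <= m.
    have [->|ne] := eqVneq e 0; first by rewrite mulr0.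
    by rewrite divfK.
  by have := mnu i j; rewrite mulrN; lra.
- move=> i; under eq_bigr do rewrite mxE [X in _ + X]mxE.
  rewrite big_split/= nur gerDl -mulr_sumr mulr_ge0_le0//.
  apply: le_trans (mdot_perp_cone (real_mx q) (cone_row i)).
  rewrite -/p /mdot [leRHS](bigD1 i)//= [X in _ + X]big1 ?addr0; last first.
    by move=> k ki; rewrite big1// => j _; rewrite [X in _ * X]mxE (negPf ki) mulr0.
  by apply: ler_sum => j _; rewrite [X in _ * X]mxE eqxx mulr1.
- move=> j; under eq_bigr do rewrite mxE [X in _ + X]mxE.
  rewrite big_split/= nuc gerDl -mulr_sumr mulr_ge0_le0//.
  apply: le_trans (mdot_perp_cone (real_mx q) (cone_col j)).
  rewrite -/p /mdot [leRHS]exchange_big [leRHS](bigD1 j)//= [X in _ + X]big1 ?addr0; last first.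
    by move=> k ki; rewrite big1// => i _; rewrite [X in _ * X]mxE (negPf ki) mulr0.
  by apply: ler_sum => i _; rewrite [X in _ * X]mxE eqxx mulr1.
Qed.

(** * Independence and drift in steady state *)

Section BoundedRandomVariables.
Context {R : realType} {d : measure_display} {Omega : measurableType d}.
Context (P : probability Omega R).
Implicit Types f g : Omega -> R.

Definition bounded_rv f :=
  measurable_fun setT f /\ exists C, forall w, `|f w| <= C.

Lemma bounded_rv_integrable f : bounded_rv f -> P.-integrable setT (EFin \o f).
Proof.
move=> [mf [C fC]]; apply: measurable_bounded_integrable => //.
  by rewrite ltey_eq fin_num_measure.
by exists C; split; [exact: num_real|move=> x Cx w _ /=; rewrite (le_trans (fC w))// ltW].
Qed.

Lemma bounded_rv_cst c : bounded_rv (cst c).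
Proof. by split; [exact: measurable_cst|exists `|c|]. Qed.

Lemma bounded_rvD f g : bounded_rv f -> bounded_rv g ->
  bounded_rv (fun w => f w + g w).
Proof.
move=> [mf [C fC]] [mg [D gD]]; split; first exact: measurable_funD.
by exists (C + D) => w; rewrite (le_trans (ler_normD _ _))// lerD.
Qed.

Lemma bounded_rvM f g : bounded_rv f -> bounded_rv g ->
  bounded_rv (fun w => f w * g w).
Proof.
move=> [mf [C fC]] [mg [D gD]]; split; first exact: measurable_funM.
by exists (C * D) => w; rewrite normrM ler_pM.
Qed.

Lemma bounded_rvB f g : bounded_rv f -> bounded_rv g ->
  bounded_rv (fun w => f w - g w).
Proof.
move=> [mf [C fC]] [mg [D gD]]; split; first exact: measurable_funB.
by exists (C + D) => w; rewrite (le_trans (ler_normB _ _))// lerD.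
Qed.

Lemma bounded_rv_sum (I : Type) (s : seq I) (h : I -> Omega -> R) :
  (forall i, bounded_rv (h i)) -> bounded_rv (fun w => \sum_(i <- s) h i w).
Proof.
move=> bh; elim: s => [|i s IH].
  by under eq_fun do rewrite big_nil; exact: bounded_rv_cst.
by under eq_fun do rewrite big_cons; exact: bounded_rvD.
Qed.

Lemma Rintegral_sum (I : Type) (s : seq I) (h : I -> Omega -> R) :
  (forall i, bounded_rv (h i)) ->
  \int[P]_w (\sum_(i <- s) h i w) = \sum_(i <- s) \int[P]_w h i w.
Proof.
move=> bh; elim: s => [|i s IH].
  under eq_Rintegral do rewrite big_nil.
  by rewrite Rintegral_cst// mul0r big_nil.
under eq_Rintegral do rewrite big_cons.
rewrite RintegralD// ?big_cons ?IH//; apply: bounded_rv_integrable => //.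
exact: bounded_rv_sum.
Qed.

Lemma Rintegral_prob_cst (c : R) : \int[P]_w c = c.
Proof.
rewrite Rintegral_cst// (_ : _ setT = 1%E) ?mulr1//.
exact: probability_setT.
Qed.

Lemma discrete_rv_comp (T : Type) (Y : Omega -> T) (h : T -> R) :
  discrete_rv Y -> measurable_fun setT (h \o Y).
Proof. by move=> dY _ B mB; rewrite setTI; exact: (dY (h @^-1` B)). Qed.

Lemma bounded_rv_comp (T : Type) (Y : Omega -> T) (h : T -> R) (C : R) :
  discrete_rv Y -> (forall w, `|h (Y w)| <= C) -> bounded_rv (fun w => h (Y w)).
Proof. by move=> dY hC; split; [exact: discrete_rv_comp|exists C]. Qed.

(** [T] carries no sigma-algebra, so the space is cut along the codes [pickle (Z w)]. Each piece is
    empty or the fibre of a single value, on which functions of [Z] are constant; the independence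
    lemmas below rest on this instead of product measures. *)
Lemma ge0_integral_discrete (T : countType) (Z : Omega -> T) (E : set Omega)
    (f : Omega -> \bar R) :
  discrete_rv Z -> measurable E -> measurable_fun setT f ->
  (forall w, 0 <= f w)%E ->
  (\int[P]_(w in E) f w =
   \sum_(k <oo) \int[P]_(w in E `&` [set w | pickle (Z w) = k]) f w)%E.
Proof.
move=> dZ mE mf f0.
pose F k := E `&` [set w | pickle (Z w) = k].
have FE : \bigcup_k F k = E.
  apply/seteqP; split=> [w [k _ []]//|w Ew]; by exists (pickle (Z w)).
rewrite -{1}FE ge0_integral_bigcup//.
- by move=> k; apply: measurableI => //; exact: (dZ [set z | pickle z = k]).
- exact: measurable_funTS.
- by move=> i j _ _ [w [[_ /= <-] [_ /= <-]]].
Qed.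

Lemma pickle_fiber (T : countType) (Z : Omega -> T) k :
  [set w | pickle (Z w) = k] = set0 \/
  exists z, [set w | pickle (Z w) = k] = Z @^-1` [set z].
Proof.
have [[w0 wk]|none] := pselect (exists w, pickle (Z w) = k).
  right; exists (Z w0); apply/seteqP; split=> w /=; last by move=> ->.
  by rewrite -wk => /(pcan_inj pickleK).
by left; apply/seteqP; split=> // w /= wk; apply: none; exists w.
Qed.

Lemma integral_indep_event (A : countType) (Y : Omega -> A) (E : set Omega)
    (h : A -> R) :
  discrete_rv Y -> measurable E ->
  (forall y, P (E `&` Y @^-1` [set y]) = (P E * P (Y @^-1` [set y]))%E) ->
  (forall y, 0 <= h y) ->
  (\int[P]_(w in E) (h (Y w))%:E = P E * \int[P]_w (h (Y w))%:E)%E.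
Proof.
move=> dY mE ind h0.
have mh : measurable_fun setT (fun w => (h (Y w))%:E).
  by apply/measurable_EFinP; exact: discrete_rv_comp.
have h0' w : (0 <= (h (Y w))%:E)%E by rewrite lee_fin.
rewrite (ge0_integral_discrete dY mE mh h0').
rewrite (ge0_integral_discrete dY measurableT mh h0').
have PEfin : P E = (fine (P E))%:E by rewrite fineK// fin_num_measure.
rewrite PEfin -nneseriesZl -?PEfin => [|k _]; last exact: integral_ge0.
apply: eq_eseriesr => k _.
have [->|[y ->]] := pickle_fiber Y k; first by rewrite !setI0 !integral_set0 mule0.
have ev D : measurable D ->
    (\int[P]_(w in D `&` Y @^-1` [set y]) (h (Y w))%:E =
     (h y)%:E * P (D `&` Y @^-1` [set y]))%E.
  move=> mD; rewrite -integral_cst; last exact: measurableI.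
  by apply: eq_integral => w; rewrite inE => -[_ /= ->].
by rewrite !ev// setTI ind muleCA.
Qed.

Lemma integral_indep (T A : countType) (Z : Omega -> T) (Y : Omega -> A)
    (F : T -> R) (h : A -> R) :
  discrete_rv Z -> discrete_rv Y ->
  (forall z y, P (Z @^-1` [set z] `&` Y @^-1` [set y]) =
               (P (Z @^-1` [set z]) * P (Y @^-1` [set y]))%E) ->
  (forall z, 0 <= F z) -> (forall y, 0 <= h y) ->
  bounded_rv (fun w => h (Y w)) ->
  (\int[P]_w (F (Z w) * h (Y w))%:E =
   \int[P]_w (F (Z w))%:E * \int[P]_w (h (Y w))%:E)%E.
Proof.
move=> dZ dY ind F0 h0 bh.
have mF : measurable_fun setT (fun w => (F (Z w))%:E).
  by apply/measurable_EFinP; exact: discrete_rv_comp.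
have mh : measurable_fun setT (fun w => (h (Y w))%:E).
  by apply/measurable_EFinP; exact: discrete_rv_comp.
rewrite (ge0_integral_discrete dZ measurableT); last first.
- by move=> w; rewrite lee_fin mulr_ge0.
- by apply/measurable_EFinP; apply: measurable_funM; exact: discrete_rv_comp.
rewrite (ge0_integral_discrete dZ measurableT mF); last by move=> w; rewrite lee_fin.
have hfin : (\int[P]_w (h (Y w))%:E = (fine (\int[P]_w (h (Y w))%:E))%:E)%E.
  by rewrite fineK// integrable_fin_num//; exact: bounded_rv_integrable.
rewrite muleC hfin -nneseriesZl -?hfin => [|k _]; last first.
  by apply: integral_ge0 => w _; rewrite lee_fin.
apply: eq_eseriesr => k _; rewrite !setTI.
have [->|[z Ez]] := pickle_fiber Z k; first by rewrite !integral_set0 mule0.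
have mz : measurable (Z @^-1` [set z]) by exact: dZ.
rewrite Ez.
transitivity ((F z)%:E * (P (Z @^-1` [set z]) * \int[P]_w (h (Y w))%:E))%E.
  rewrite -integral_indep_event// -ge0_integralZl_EFin//; last 2 first.
  - by move=> w _; rewrite lee_fin.
  - exact: measurable_funTS.
  by apply: eq_integral => w; rewrite inE => /= ->; rewrite EFinM.
rewrite muleA muleC; congr (_ * _)%E.
by rewrite -integral_cst//; apply: eq_integral => w; rewrite inE => /= ->.
Qed.

(** Adding a bound [C] makes [F] nonnegative; the contribution of the constant is subtracted
    afterwards. *)
Lemma Rintegral_indep (T A : countType) (Z : Omega -> T) (Y : Omega -> A)
    (F : T -> R) (h : A -> R) :
  discrete_rv Z -> discrete_rv Y ->
  (forall z y, P (Z @^-1` [set z] `&` Y @^-1` [set y]) =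
               (P (Z @^-1` [set z]) * P (Y @^-1` [set y]))%E) ->
  (exists C, forall z, `|F z| <= C) -> (forall y, 0 <= h y) ->
  bounded_rv (fun w => h (Y w)) ->
  \int[P]_w (F (Z w) * h (Y w)) = \int[P]_w F (Z w) * \int[P]_w h (Y w).
Proof.
move=> dZ dY ind [C FC] h0 bh.
have bF : bounded_rv (fun w => F (Z w)) by exact: (bounded_rv_comp dZ).
have FC0 z : 0 <= F z + C by have := FC z; rewrite ler_norml => /andP[? _]; lra.
have bFC : bounded_rv (fun w => F (Z w) + C).
  by apply: bounded_rvD => //; exact: bounded_rv_cst.
have /(congr1 fine) := @integral_indep _ _ Z Y (fun z => F z + C) h dZ dY ind FC0 h0 bh.
rewrite fineM; last 2 first.
- by rewrite integrable_fin_num//; exact: (bounded_rv_integrable bFC).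
- by rewrite integrable_fin_num//; exact: (bounded_rv_integrable bh).
rewrite -!/(Rintegral P setT _) => E.
have -> : \int[P]_w (F (Z w) * h (Y w)) =
    \int[P]_w ((F (Z w) + C) * h (Y w)) - C * \int[P]_w h (Y w).
  rewrite -RintegralZl//; last exact: bounded_rv_integrable.
  rewrite -RintegralB//; last 2 first.
  - by apply: bounded_rv_integrable; apply: bounded_rvM.
  - by apply: bounded_rv_integrable; apply: bounded_rvM => //; exact: bounded_rv_cst.
  by apply: eq_Rintegral => w _; ring.
rewrite E RintegralD//; last 2 first.
- exact: bounded_rv_integrable.
- by apply: bounded_rv_integrable; exact: bounded_rv_cst.
by rewrite Rintegral_prob_cst; ring.
Qed.

End BoundedRandomVariables.

Section Limits.
Context {R : realType} {d : measure_display} {Omega : measurableType d}.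
Context (P : probability Omega R).

Lemma cvg_Rintegral_dominated (f_ : nat -> Omega -> R) (f g : Omega -> R) :
  (forall k, measurable_fun setT (f_ k)) -> measurable_fun setT f ->
  P.-integrable setT (EFin \o g) -> (forall k w, `|f_ k w| <= g w) ->
  (forall w, exists k0, forall k, (k0 <= k)%N -> f_ k w = f w) ->
  \int[P]_w f_ k w @[k --> \oo] --> \int[P]_w f w.
Proof.
move=> mf_ mf ig fg ev.
have [||||intf _ cvgf] := @dominated_convergence _ _ _ P setT measurableT
    (fun k => EFin \o f_ k) (EFin \o f) (EFin \o g) _ _ _ ig.
- by move=> k; exact/measurable_EFinP.
- exact/measurable_EFinP.
- apply: aeW => w _; have [k0 fk0] := ev w.
  apply/fine_cvgP; split; first by near=> k.
  apply: cvg_near_cst; near=> k; apply/eqP; rewrite /= fk0//.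
  by near: k; exact: nbhs_infty_ge.
- by apply: aeW => w k _; rewrite /= lee_fin.
apply: fine_cvg => /=; rewrite fineK; last exact: integrable_fin_num.
exact: cvgf.
Unshelve. all: by end_near. Qed.

(** Monotone convergence: [Phi] is finite, so its sublevel sets exhaust the space. The cut is made
    along [Phi] and not along [Q] because drift estimates are available on sublevel sets of the
    Lyapunov function. *)
Lemma integrable_truncations (Q Phi : Omega -> R) (C : R) :
  measurable_fun setT Q -> measurable_fun setT Phi -> (forall w, 0 <= Q w) ->
  (forall k : nat, bounded_rv (fun w => if Phi w <= k%:R then Q w else 0) /\
    \int[P]_w (if Phi w <= k%:R then Q w else 0) <= C) ->
  P.-integrable setT (EFin \o Q).
Proof.
move=> mQ mPhi Q0 hC.
pose g k w := (if Phi w <= k%:R then Q w else 0)%:E.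
have g0 k w : (0 <= g k w)%E by rewrite /g lee_fin; case: ifP.
have mg k : measurable_fun setT (g k).
  by apply/measurable_EFinP; exact: (hC k).1.1.
have ng w : {homo g^~ w : k l / (k <= l)%N >-> (k <= l)%E}.
  move=> k l kl; rewrite /g lee_fin; case: ifP => [Pk|_]; last by case: ifP.
  by rewrite (le_trans Pk)// ler_nat.
have cg : (\int[P]_w g k w)%E @[k --> \oo] --> (\int[P]_w (Q w)%:E)%E.
  have := @cvg_monotone_convergence _ _ _ P setT measurableT g mg
     (fun k w _ => g0 k w) (fun w _ => ng w).
  suff -> : (\int[P]_w limn (g^~ w) = \int[P]_w (Q w)%:E)%E by [].
  apply: eq_integral => w _; apply/cvg_lim => //.
  apply: cvg_near_cst; near=> k; rewrite /g ifT//.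
  apply: (@le_trans _ _ (Num.truncn `|Phi w|).+1%:R).
    by rewrite (le_trans (ler_norm _))// ltW// truncnS_gt.
  by rewrite ler_nat; near: k; exact: nbhs_infty_ge.
apply/integrableP; split; first exact/measurable_EFinP.
under eq_integral do rewrite /= ger0_norm//.
apply: (@le_lt_trans _ _ C%:E); last exact: ltry.
apply: (cvge_to_le cg); near=> k.
have [bk] := hC k; rewrite -lee_fin; apply: le_trans.
rewrite /Rintegral fineK//; exact/integrable_fin_num/bounded_rv_integrable.
Unshelve. all: by end_near. Qed.

End Limits.

Section DiscretePaths.
Context {R : realType} {d : measure_display} {Omega : measurableType d}.
Context (P : probability Omega R).

Lemma discrete_rv_fibers (T : countType) (Z : Omega -> T) :
  (forall z, measurable (Z @^-1` [set z])) -> discrete_rv Z.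
Proof.
move=> mZ B.
have -> : Z @^-1` B =
    \bigcup_k (Z @^-1` [set z | B z] `&` [set w | pickle (Z w) = k]).
  by apply/seteqP; split=> [w Bw|w [k _ []]//]; exists (pickle (Z w)).
apply: bigcupT_measurable => k.
have [->|[z ->]] := pickle_fiber Z k; first by rewrite setI0.
have [Bz|Bz] := pselect (B z).
  rewrite (_ : _ `&` _ = Z @^-1` [set z])//.
  by apply/seteqP; split=> [w []//|w /= wz]; split=> //=; rewrite wz.
rewrite (_ : _ `&` _ = set0)//.
by apply/seteqP; split=> // w [/= + wz]; rewrite wz.
Qed.

Lemma discrete_rv_pair (T U : countType) (Z : Omega -> T) (Y : Omega -> U) :
  discrete_rv Z -> discrete_rv Y -> discrete_rv (fun w => (Z w, Y w)).
Proof.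
move=> dZ dY; apply: discrete_rv_fibers => -[z y].
rewrite (_ : _ @^-1` _ = Z @^-1` [set z] `&` Y @^-1` [set y]).
  by apply: measurableI; [exact: dZ|exact: dY].
by apply/seteqP; split=> w /=; [case=> -> ->|case=> -> ->].
Qed.

Context {T : countType} (Y : nat -> Omega -> T).

(** The whole past as a single variable with countably many values: the path events in
    [independent_of_past] are its fibres over lists of length [t.+1]. *)
Definition trajectory t w := [seq Y k w | k <- iota 0 t.+1].

Lemma trajectory_fiber t (p : seq T) (y0 : T) : size p = t.+1 ->
  trajectory t @^-1` [set p] = path_event Y t (nth y0 p).
Proof.
move=> sp; apply/seteqP; split=> w.
  move=> /= wp k kt; rewrite -wp /trajectory (nth_map 0%N) ?size_iota//.
  by rewrite nth_iota.
move=> wp; apply: (@eq_from_nth _ y0); rewrite size_map size_iota ?sp// => k kt.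
by rewrite (nth_map 0%N) ?size_iota// nth_iota// wp.
Qed.

Lemma trajectory_fiber0 t (p : seq T) : size p != t.+1 ->
  trajectory t @^-1` [set p] = set0.
Proof.
move=> sp; apply/seteqP; split=> // w /= wp.
by move: sp; rewrite -wp size_map size_iota eqxx.
Qed.

Lemma path_event_measurable t y : (forall k, discrete_rv (Y k)) ->
  measurable (path_event Y t y).
Proof.
move=> dY; rewrite (_ : path_event Y t y =
  \bigcap_(k in [set k | (k <= t)%N]) Y k @^-1` [set y k])//.
apply: bigcap_measurable; first by exists 0%N.
by move=> k _; exact: dY.
Qed.

Lemma discrete_trajectory t : (forall k, discrete_rv (Y k)) ->
  discrete_rv (trajectory t).
Proof.
move=> dY; apply: discrete_rv_fibers => p.
have [sp|sp] := eqVneq (size p) t.+1; last by rewrite trajectory_fiber0.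
case: p sp => // y0 p sp.
by rewrite (trajectory_fiber y0)//; exact: path_event_measurable.
Qed.

Lemma Rintegral_indep_of_past (A : countType) (a : Omega -> A) t (F : T -> R)
    (h : A -> R) :
  (forall k, discrete_rv (Y k)) -> discrete_rv a -> independent_of_past P a Y t ->
  (exists C, forall z, `|F z| <= C) -> (forall y, 0 <= h y) ->
  bounded_rv (fun w => h (a w)) ->
  \int[P]_w (F (Y t w) * h (a w)) = \int[P]_w F (Y t w) * \int[P]_w h (a w).
Proof.
move=> dY da ind [C FC] h0 bh.
have [[w0 _]|noOmega] := pselect (exists w : Omega, True); last first.
  have E : forall f : Omega -> R, \int[P]_w f w = \int[P]_w 0.
    by move=> f; apply: eq_Rintegral => w; case: noOmega; exists w.
  by rewrite (E (fun w => F (Y t w))) (E (fun w => _ * _)) Rintegral_prob_cst mul0r.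
pose last_state p := last (Y 0%N w0) p.
have lastE w : last_state (trajectory t w) = Y t w.
  rewrite /last_state /trajectory -(addn1 t) iotaD map_cat last_cat /=.
  by rewrite add0n.
transitivity (\int[P]_w ((F \o last_state) (trajectory t w) * h (a w))).
  by apply: eq_Rintegral => w _; rewrite /= lastE.
transitivity (\int[P]_w (F \o last_state) (trajectory t w) * \int[P]_w h (a w));
  last by congr (_ * _); apply: eq_Rintegral => w _; rewrite /= lastE.
apply: Rintegral_indep => //; first exact: discrete_trajectory.
  move=> p y; have [sp|sp] := eqVneq (size p) t.+1; last first.
    by rewrite trajectory_fiber0// set0I measure0 mul0e.
  by rewrite (trajectory_fiber (Y 0%N w0))// setIC ind muleC.
by exists C => p; exact: FC.
Qed.

End DiscretePaths.

Section Drift.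
Context {R : realType} {n : nat} (S : switch_process n R).
Context (Xb : random_element R (state n)).
Context (lambda : 'M[R]_n) (amax : R).
Hypotheses (mS : swp_measurable S) (markS : markov_switch S).
Hypotheses (bS : bounded_arrivals S amax) (meanS : mean_arrivals S lambda).
Hypothesis (steadyS : steady_state S Xb).

Local Notation P := (swp_prob S).
Local Notation X := (@swp_state n R S).
Local Notation a := (@swp_arr n R S).

Lemma discrete_state t : discrete_rv (X t). Proof. by case: (mS t). Qed.

Lemma arrival_bounded_rv t i j : bounded_rv (fun w => (a t w i j)%:R : R).
Proof.
apply: (@bounded_rv_comp _ _ _ _ (a t) (fun q => (q i j)%:R) amax).
  by case: (mS t).
by move=> w; rewrite ger0_norm//; exact: bS.
Qed.

Lemma Rintegral_state_arrival t i j (F : state n -> R) :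
  (exists C, forall z, `|F z| <= C) ->
  \int[P]_w (F (X t w) * (a t w i j)%:R) = \int[P]_w F (X t w) * lambda i j.
Proof.
move=> [C FC].
(* The independence hypothesis concerns the past of the state together with [swp_opt], so [F] is
   lifted to this pair. *)
pose Y k w : ('M[nat]_n * 'M[bool]_n * nat) * 'M[bool]_n := (X k w, swp_opt k w).
have dY k : discrete_rv (Y k).
  by have [_ dX ds] := mS k; exact: (@discrete_rv_pair _ _ _ _ (X k) (swp_opt k)).
have := @Rintegral_indep_of_past _ _ _ P _ Y _ (a t) t (fun y => F y.1)
  (fun q => (q i j)%:R) dY _ (markS.1 t) _ _ (arrival_bounded_rv t i j).
move=> ->//; last 2 first.
- by case: (mS t).
- by exists C.
congr (_ * _); have := meanS t i j; rewrite unlock => /(congr1 fine).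
exact.
Qed.

Lemma Rintegral_cvg_steady (F : state n -> R) :
  (exists C, forall z, `|F z| <= C) ->
  \int[P]_w F (X t w) @[t --> \oo] --> \int[re_prob Xb]_w F (re_val w).
Proof.
move=> bF; have := steadyS bF.
under eq_fun do rewrite unlock.
rewrite unlock => cF; apply: fine_cvg; rewrite fineK; first exact: cF.
apply: integrable_fin_num => //; apply: bounded_rv_integrable.
have [C FC] := bF; split; last by exists C => w; exact: FC.
exact: (discrete_rv_comp _ (@re_meas _ _ Xb)).
Qed.

(* Truncating Phi at N only decreases its drift, and the drift of the bounded
   function min(Phi, N) vanishes in the limit. *)
Lemma lyapunov_drift (Phi D : state n -> R) (m : state n -> 'M[R]_n) (N : R) :
  (forall x, 0 <= Phi x) ->
  (exists C, forall x, Phi x <= N -> `|D x| <= C) ->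
  (exists C, forall x i j, Phi x <= N -> `|m x i j| <= C) ->
  (forall t w, (0 < t)%N -> Phi (X t.+1 w) <=
     Phi (X t w) + D (X t w) + mdot (m (X t w)) (real_mx (a t w) - lambda)) ->
  0 <= \int[re_prob Xb]_w (if Phi (re_val w) <= N then D (re_val w) else 0).
Proof.
move=> Phi0 [CD DC] [Cm mC] drift.
pose G x := Num.min (Phi x) N.
pose H x := if Phi x <= N then D x else 0.
pose m' x i j := if Phi x <= N then m x i j else 0.
have bG : exists C, forall x, `|G x| <= C.
  exists `|N| => x; rewrite /G; case: (leP (Phi x) N) => // PN.
  by rewrite ger0_norm// (le_trans PN)// ler_norm.
have bH : exists C, forall x, `|H x| <= C.
  exists `|CD| => x; rewrite /H; case: ifP => [/DC h|_]; last by rewrite normr0.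
  by rewrite (le_trans h)// ler_norm.
have bm i j : exists C, forall x, `|m' x i j| <= C.
  exists `|Cm| => x; rewrite /m'; case: ifP => [/mC h|_]; last by rewrite normr0.
  by rewrite (le_trans (h _ _))// ler_norm.
have rvX t F : (exists C, forall x, `|F x| <= C) -> bounded_rv (fun w => F (X t w) : R).
  by move=> [C FC]; apply: (bounded_rv_comp (discrete_state t)) => w; exact: FC.
pose u t := \int[P]_w G (X t w); pose v t := \int[P]_w H (X t w).
have step t : (0 < t)%N -> u t.+1 - u t <= v t.
  move=> t0.
  (* [K] is the martingale part of the increment. It is centred because [m'] reads only the state,
     which is independent of the arrivals of the slot. *)
  pose K w := \sum_i \sum_j (m' (X t w) i j * (a t w i j)%:R -
     m' (X t w) i j * lambda i j).
  have bK1 i j : bounded_rv (fun w => m' (X t w) i j * (a t w i j)%:R).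
    by apply: bounded_rvM; [exact: rvX (bm i j)|exact: arrival_bounded_rv].
  have bK2 i j : bounded_rv (fun w => m' (X t w) i j * lambda i j).
    apply: bounded_rvM; [exact: rvX (bm i j)|exact: bounded_rv_cst].
  have bK : bounded_rv K.
    by do 2! apply: bounded_rv_sum => ?; exact: bounded_rvB.
  have K0 : \int[P]_w K w = 0.
    rewrite Rintegral_sum => [|i]; last first.
      by apply: bounded_rv_sum => j; exact: bounded_rvB.
    rewrite big1// => i _; rewrite Rintegral_sum => [|j]; last exact: bounded_rvB.
    rewrite big1// => j _; rewrite RintegralB//; try exact: bounded_rv_integrable.
    rewrite (Rintegral_state_arrival t i j (bm i j)) RintegralZr//.
      by rewrite subrr.
    by apply: bounded_rv_integrable; exact: (rvX t (fun x => m' x i j) (bm i j)).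
  rewrite lerBlDl -[leRHS]addr0 -K0 /u /v.
  have bGt := rvX t G bG; have bHt := rvX t H bH.
  rewrite -RintegralD//; try exact: bounded_rv_integrable.
  rewrite -RintegralD//; try exact: bounded_rv_integrable; last first.
    by apply: bounded_rv_integrable; exact: bounded_rvD.
  apply: le_Rintegral => //.
  - exact/bounded_rv_integrable/rvX.
  - by apply: bounded_rv_integrable; apply: bounded_rvD => //; exact: bounded_rvD.
  move=> w _; have := drift t w t0.
  have -> : K w = if Phi (X t w) <= N then
      mdot (m (X t w)) (real_mx (a t w) - lambda) else 0.
    rewrite /K /m' /mdot; case: ifP => _.
      by do 2! apply: eq_bigr => ? _; rewrite !mxE mulrBr.
    by do 2! rewrite big1// => ? _; rewrite !mul0r subrr.
  rewrite /G /H; case: ifP => PN.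
    by rewrite (min_idPl PN) => h; rewrite ge_min h.
  (* Above the level [N] the minimum already equals [N] and cannot increase, so 0 bounds its
     drift. *)
  have NP : N <= Phi (X t w) by rewrite ltW// ltNge PN.
  by rewrite (min_idPr NP) !addr0 ge_min lexx orbT.
have cu := Rintegral_cvg_steady bG.
have cv := Rintegral_cvg_steady bH.
have cu' : u t.+1 - u t @[t --> \oo] --> 0.
  rewrite -[0](subrr (\int[re_prob Xb]_w G (re_val w))).
  by apply: cvgB => //; rewrite (cvg_shiftS u).
apply: (ler_cvg_to cu' cv); near=> t; apply: step.
by near: t; exact: nbhs_infty_gt.
Unshelve. all: by end_near. Qed.

(** Where [Z <= N - C], one slot cannot carry [Z] beyond [N], so [max(N - Z, 0)] decreases by [eta]
    on average; elsewhere it increases by at most [C]. The resulting drift [D N] has nonnegative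
    steady-state mean for every [N], yet this mean tends to [- eta] by dominated convergence. *)
Lemma no_steady_state (Z : state n -> R) (m : state n -> 'M[R]_n) (eta C : R) :
  0 < eta -> 0 <= C -> (forall x, 0 <= Z x) ->
  (exists C', forall x i j, `|m x i j| <= C') ->
  (forall t w, (0 < t)%N -> `|Z (X t.+1 w) - Z (X t w)| <= C) ->
  (forall t w, (0 < t)%N ->
     Z (X t w) + eta + mdot (m (X t w)) (real_mx (a t w) - lambda) <=
     Z (X t.+1 w)) ->
  False.
Proof.
move=> eta0 C0 Z0 [C' mC] incr drift.
pose D (N : nat) x := if Z x <= N%:R - C then - eta else C.
have key N : 0 <= \int[re_prob Xb]_w D N (re_val w).
  pose Phi x := Num.max (N%:R - Z x) 0.
  have PhiN x : Phi x <= N%:R by rewrite ge_max ler0n andbT gerBl.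
  have := @lyapunov_drift Phi (D N) (fun x => if Z x <= N%:R - C then - m x else 0) N%:R.
  under eq_Rintegral do rewrite PhiN.
  apply.
  - by move=> x; rewrite le_max lexx orbT.
  - exists (eta + C) => x _; rewrite /D; case: ifP => _.
      by rewrite normrN gtr0_norm// lerDl.
    by rewrite ger0_norm// lerDr ltW.
  - exists `|C'| => x i j _; case: ifP => _; last by rewrite mxE normr0.
    by rewrite mxE normrN (le_trans (mC _ _ _))// ler_norm.
  move=> t w t0; have := incr t w t0; rewrite ler_norml => /andP[lo up].
  have := drift t w t0; rewrite /Phi /D.
  set z := Z (X t w) in lo up *; set z' := Z (X t.+1 w) in lo up *.
  case: ifP => zN dr.
    rewrite mdotNl (_ : Num.max (N%:R - z') 0 = N%:R - z'); last first.
      by apply/max_idPl; lra.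
    rewrite (_ : Num.max (N%:R - z) 0 = N%:R - z); last by apply/max_idPl; lra.
    by lra.
  rewrite (_ : mdot 0 _ = 0); last first.
    by rewrite /mdot; do 2! rewrite big1// => ? _; rewrite mxE mul0r.
  rewrite addr0; have m1 : N%:R - z <= Num.max (N%:R - z) 0 by rewrite le_max lexx.
  have m2 : 0 <= Num.max (N%:R - z) 0 by rewrite le_max lexx orbT.
  by rewrite ge_max; apply/andP; split; lra.
have cD : \int[re_prob Xb]_w D N (re_val w) @[N --> \oo] --> \int[re_prob Xb]_w (- eta).
  apply: (@cvg_Rintegral_dominated _ _ _ _ _ _ (cst (eta + C))).
  - by move=> N; exact: (discrete_rv_comp (D N) (@re_meas _ _ Xb)).
  - exact: measurable_cst.
  - exact/bounded_rv_integrable/bounded_rv_cst.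
  - move=> N w; rewrite /D; case: ifP => _.
      by rewrite normrN gtr0_norm// lerDl.
    by rewrite ger0_norm// lerDr ltW.
  move=> w; exists (Num.truncn (Z (re_val w) + C)).+1 => N; rewrite -(ler_nat R) => NZ.
  rewrite /D ifT// lerBrDr; apply: le_trans NZ.
  by rewrite ltW// truncnS_gt.
have : 0 <= \int[re_prob Xb]_w (- eta).
  by apply: (cvgr_to_ge cD); near=> N; exact: key.
by rewrite Rintegral_prob_cst oppr_ge0 leNgt eta0.
Unshelve. all: by end_near. Qed.

End Drift.

(** * Sample paths of the switch *)

Section Steps.
Context {R : realType} {n : nat}.
Implicit Types (q : 'M[nat]_n.+1) (s : 'M[bool]_n.+1) (x : state n.+1).

Definition backlog q : R := \sum_i \sum_j (q i j)%:R.
Definition wmax q : R := (max_weight q)%:R.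
Definition gap q s : R := wmax q - (weight q s)%:R.

(** The pathwise content of one slot, detached from the probability space. Reconfiguration times
    enter only through the recursion [step_remain], obtained from the closed formula in
    [remain_succ]. *)
Record switch_step (Dr : nat) (g : R -> R) (amax : R) (a : 'M[nat]_n.+1)
    (rc : bool) (x y : state n.+1) : Prop := SwitchStep {
  step_queue : forall i j,
    y.1.1 i j = (x.1.1 i j + a i j - x.1.2 i j * (x.2 == 0))%N;
  step_arrival : forall i j, (a i j)%:R <= amax;
  step_feasible : feasible x.1.2;
  step_feasible' : feasible y.1.2;
  step_reconf : rc = (g (wmax x.1.1) < gap x.1.1 x.1.2);
  step_opt : rc -> weight x.1.1 y.1.2 = max_weight x.1.1;
  step_sched : ~~ rc -> y.1.2 = x.1.2;
  step_remain : y.2 = if rc then Dr else x.2.-1;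
  step_delay : (x.2 <= Dr)%N }.

Lemma max_weight_attained q : exists2 s, feasible s & weight q s = max_weight q.
Proof.
have fs0 : feasible (const_mx false : 'M[bool]_n.+1).
  apply/andP; split; apply/forallP => j;
  by rewrite big1// => i _; rewrite mxE.
have [|s fs sE] := @eq_bigmax_cond _ (fun s => feasible s) (weight q).
  by apply/card_gt0P; exists (const_mx false).
by exists s.
Qed.

Lemma gap_ge0 q s : feasible s -> 0 <= gap q s.
Proof. by move=> fs; rewrite subr_ge0 ler_nat weight_le_max. Qed.

Lemma backlog_ge0 q : 0 <= backlog q.
Proof. by do 2! apply: sumr_ge0 => ? _. Qed.

Lemma weight_le_backlog q s : (weight q s)%:R <= backlog q.
Proof.
rewrite weightE; apply: ler_sum => i _; apply: ler_sum => j _.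
by rewrite !mxE; case: (s i j); rewrite ?mulr1// mulr0.
Qed.

Lemma wmax_le_backlog q : wmax q <= backlog q.
Proof.
have [s _ sE] := max_weight_attained q.
by rewrite /wmax -sE weight_le_backlog.
Qed.

(** The matrix with all entries equal to the inverse of the size is doubly stochastic. *)
Lemma backlog_le_wmax q : backlog q <= n.+1%:R * wmax q.
Proof.
have N0 : 0 < n.+1%:R :> R by rewrite ltr0n.
have := @mdot_le_max_weight R n (const_mx n.+1%:R^-1) q.
rewrite -(ler_pM2l N0).
have -> : n.+1%:R * mdot (real_mx q) (const_mx n.+1%:R^-1) = backlog q.
  rewrite /mdot mulr_sumr; apply: eq_bigr => i _; rewrite mulr_sumr.
  by apply: eq_bigr => j _; rewrite !mxE mulrCA divff ?mulr1// gt_eqF.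
apply=> [i j|i|j]; first by rewrite mxE invr_ge0 ltW.
- under eq_bigr do rewrite mxE.
  by rewrite sumr_const card_ord -[X in X <= _](mulr_natl _ n.+1) divff// gt_eqF.
- under eq_bigr do rewrite mxE.
  by rewrite sumr_const card_ord -[X in X <= _](mulr_natl _ n.+1) divff// gt_eqF.
Qed.

Section OneStep.
Variables (Dr : nat) (g : R -> R) (amax : R) (a : 'M[nat]_n.+1) (rc : bool).
Variables (x y : state n.+1).
Hypothesis xy : switch_step Dr g amax a rc x y.

Let b := amax + 1.
Let B := (n.+1 * n.+1)%:R * b.

Lemma step_amax_ge0 : 0 <= amax.
Proof. exact: le_trans (step_arrival xy ord0 ord0). Qed.

Lemma step_bound_gt0 : 0 < B.
Proof.
by rewrite mulr_gt0 ?ltr0n// /b; have := step_amax_ge0; lra.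
Qed.

Lemma step_entry i j :
  let c : R := (x.1.2 i j * (x.2 == 0))%N%:R in
  (y.1.1 i j)%:R = Num.max ((x.1.1 i j)%:R + (a i j)%:R - c) 0.
Proof.
rewrite /= (step_queue xy); set c := (_ * _)%N; set k := (_ + a i j)%N.
rewrite -natrD -/k; have [ck|kc] := leqP c k.
  by rewrite natrB//; apply/esym/max_idPl; rewrite subr_ge0 ler_nat.
have -> : (k - c = 0)%N by apply/eqP; rewrite subn_eq0 ltnW.
by apply/esym/max_idPr; rewrite subr_le0 ler_nat ltnW.
Qed.

Lemma step_entry_bound i j : `|(y.1.1 i j)%:R - (x.1.1 i j)%:R| <= b.
Proof.
rewrite step_entry; set c : R := (_ * _)%N%:R.
have c0 : 0 <= c by [].
have c1 : c <= 1 by rewrite /c lern1; case: (x.1.2 i j); case: (_ == _).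
have a0 : 0 <= (a i j)%:R :> R by [].
have q0 : 0 <= (x.1.1 i j)%:R :> R by [].
have aa := step_arrival xy i j.
by rewrite ler_norml /b; case: (leP (_ - c) 0) => h; apply/andP; split; lra.
Qed.

Lemma sum_entries_bound (F : 'I_n.+1 -> 'I_n.+1 -> R) :
  (forall i j, `|F i j| <= b) -> `|\sum_i \sum_j F i j| <= B.
Proof.
move=> Fb; rewrite (le_trans (ler_norm_sum _ _ _))//.
apply: (@le_trans _ _ (\sum_(i < n.+1) \sum_(j < n.+1) b)).
  apply: ler_sum => i _; rewrite (le_trans (ler_norm_sum _ _ _))//.
  exact: ler_sum.
by rewrite !sumr_const !card_ord -mulrnA /B mulr_natl.
Qed.

Lemma step_weight s : `|(weight y.1.1 s)%:R - (weight x.1.1 s)%:R : R| <= B.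
Proof.
rewrite !weightE /mdot -sumrB; under eq_bigr do rewrite -sumrB.
apply: sum_entries_bound => i j; rewrite !mxE -mulrBl normrM.
rewrite (le_trans _ (step_entry_bound i j))//.
by rewrite ler_piMr//; case: (s i j); rewrite ?normr1// normr0.
Qed.

Lemma step_backlog : `|backlog y.1.1 - backlog x.1.1| <= B.
Proof.
rewrite /backlog -sumrB; under eq_bigr do rewrite -sumrB.
by apply: sum_entries_bound => i j; exact: step_entry_bound.
Qed.

Lemma step_wmax : `|wmax y.1.1 - wmax x.1.1| <= B.
Proof.
have [s fs sE] := max_weight_attained x.1.1.
have [s' fs' sE'] := max_weight_attained y.1.1.
have := step_weight s; have := step_weight s'; rewrite !ler_norml.
have := weight_le_max y.1.1 fs; have := weight_le_max x.1.1 fs'.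
rewrite -!(ler_nat R) /wmax -sE -sE' => h1 h2 /andP[h3 h4] /andP[h5 h6].
by apply/andP; split; lra.
Qed.

(** The new schedule was optimal for the previous queues, and since then its weight and the maximal
    weight have each moved by at most [B]. *)
Lemma step_gap_reconf : rc -> gap y.1.1 y.1.2 <= 2 * B.
Proof.
move=> rct; rewrite /gap; have := step_wmax; have := step_weight y.1.2.
rewrite (step_opt xy rct) -/(wmax _) !ler_norml.
by move=> /andP[h1 h2] /andP[h3 h4]; lra.
Qed.

Lemma step_gap_keep : ~~ rc -> gap y.1.1 y.1.2 <= gap x.1.1 x.1.2 + 2 * B.
Proof.
move=> rct; rewrite (step_sched xy rct) /gap.
have := step_wmax; have := step_weight x.1.2; rewrite !ler_norml.
by move=> /andP[h1 h2] /andP[h3 h4]; lra.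
Qed.

Lemma step_remain_le : (y.2 <= Dr)%N.
Proof.
rewrite (step_remain xy); case: rc => //.
exact: leq_trans (leq_pred _) (step_delay xy).
Qed.

(** Truncation at 0 only decreases the square. In the expansion, the product of arrival and service
    has a favourable sign and the two remaining squares are at most [amax ^+ 2] and 1. The term in
    [real_mx a - lambda] is kept apart because it averages out when [lambda] is the arrival rate. *)
Lemma step_square (lambda : 'M[R]_n.+1) :
  mdot (real_mx y.1.1) (real_mx y.1.1) <=
  mdot (real_mx x.1.1) (real_mx x.1.1)
  + mdot (2 *: real_mx x.1.1) (real_mx a - lambda)
  + 2 * (mdot (real_mx x.1.1) lambda
         - (weight x.1.1 x.1.2)%:R * (x.2 == 0)%:R)
  + (n.+1 * n.+1)%:R * (amax ^+ 2 + 1).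
Proof.
rewrite weightE.
have -> : (n.+1 * n.+1)%:R * (amax ^+ 2 + 1) =
    \sum_(i < n.+1) \sum_(j < n.+1) (amax ^+ 2 + 1).
  by rewrite !sumr_const !card_ord -mulrnA mulr_natl.
rewrite /mdot mulr_suml -sumrB mulr_sumr -!big_split /=; apply: ler_sum => i _.
rewrite mulr_suml -sumrB mulr_sumr -!big_split /=; apply: ler_sum => j _.
rewrite !mxE step_entry natrM.
set q : R := (x.1.1 i j)%:R; set s : R := (x.1.2 i j)%:R.
set f : R := (x.2 == 0)%:R; set k : R := (a i j)%:R.
have a0 : 0 <= k by []; have aa : k <= amax := step_arrival xy i j.
have a2 : k ^+ 2 <= amax ^+ 2 by rewrite ler_pXn2r ?nnegrE// (le_trans a0).
have sf0 : 0 <= s * f by rewrite mulr_ge0 ?ler0n.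
have sf1 : (s * f) ^+ 2 <= 1.
  rewrite /s /f; case: (x.1.2 i j); case: (x.2 == 0);
  by rewrite ?mulr1 ?mulr0 ?expr1n ?expr0n ?ler01.
apply: (@le_trans _ _ ((q + k - s * f) ^+ 2)).
  by case: (leP (q + k - s * f) 0) => h; rewrite ?mulr0 ?sqr_ge0 -?expr2.
have ksf : 0 <= k * (s * f) by exact: mulr_ge0.
by lra.
Qed.

End OneStep.
End Steps.

Section SystemSteps.
Context {R : realType} {n : nat} (S : switch_process n.+1 R).
Context (Dr : nat) (g : R -> R) (amax : R).
Hypotheses (sysS : is_switch_system S Dr g) (bS : bounded_arrivals S amax).

Local Notation X := (@swp_state n.+1 R S).

Lemma last_reconf t w :
  (exists k, [/\ (k <= t)%N, swp_reconf k w &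
     forall k', (k < k' <= t)%N -> ~~ swp_reconf (s := S) k' w]) \/
  (forall k, (k <= t)%N -> ~~ swp_reconf (s := S) k w).
Proof.
elim: t => [|t [[k [kt rk none]]|none]].
- have [r0|r0] := boolP (swp_reconf (s := S) 0%N w).
    by left; exists 0%N; split=> // k'; lia.
  by right => k; rewrite leqn0 => /eqP ->.
- left; have [r1|r1] := boolP (swp_reconf (s := S) t.+1 w).
    by exists t.+1; split=> // k'; lia.
  exists k; split=> //; first lia.
  move=> k' /andP[kk']; rewrite leq_eqVlt => /predU1P[->//|k't].
  by apply: none; rewrite kk'.
have [r1|r1] := boolP (swp_reconf (s := S) t.+1 w).
  by left; exists t.+1; split=> // k'; lia.
by right=> k; rewrite leq_eqVlt => /predU1P[->//|/none].
Qed.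

Lemma remain_succ t w : swp_remain (s := S) t.+1 w =
  if swp_reconf t.+1 w then Dr else (swp_remain t w).-1.
Proof.
have [_ _ delay _ _] := sysS.
case: ifPn => [r1|r1].
  have /(_ t.+1 (leqnn _) r1) := (delay t.+1 w).1.
  rewrite subnn subn0; apply=> k'; lia.
have [[k [kt rk none]]|none] := last_reconf t w.
  rewrite ((delay t w).1 k kt rk none) ((delay t.+1 w).1 k _ rk); [lia|lia|].
  move=> k' /andP[kk']; rewrite leq_eqVlt => /predU1P[->//|k't].
  by apply: none; rewrite kk'.
rewrite (delay t w).2// (delay t.+1 w).2// => k.
by rewrite leq_eqVlt => /predU1P[->//|/none].
Qed.

Lemma remain_le t w : (swp_remain (s := S) t w <= Dr)%N.
Proof.
have [_ _ delay _ _] := sysS.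
have [[k [kt rk none]]|none] := last_reconf t w.
  by rewrite ((delay t w).1 k kt rk none) leq_subr.
by rewrite (delay t w).2.
Qed.

Lemma sched_feasible t w : feasible (swp_sched (s := S) t w).
Proof.
have [_ _ _ [fs0 mw] _] := sysS.
elim: t => // t IH; have [fo _ _ ->] := mw t w.
by case: ifP.
Qed.

Lemma system_step t w :
  switch_step Dr g amax (swp_arr t w) (swp_reconf t.+1 w) (X t w) (X t.+1 w).
Proof.
have [_ dyn _ [_ mw] _] := sysS; have [fo wo rE sE] := mw t w.
split=> //=.
- by move=> i j; exact: bS.
- exact: sched_feasible.
- exact: sched_feasible.
- by move=> r1; rewrite sE r1.
- by move=> r1; rewrite sE (negPf r1).
- exact: remain_succ.
- exact: remain_le.
Qed.

End SystemSteps.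

(** The slot from [x0] to [x] is included because the gap at an idle state [x] is controlled by the
    decision taken one slot before. Neither [C] nor [Phi] may depend on [lambda], which makes the
    final constant uniform over the systems. *)
Definition drift_certificate (R : realType) n g (Dr : nat) (amax kappa C : R) :=
  0 <= C /\ exists2 Phi : state n.+1 -> R,
    forall x, feasible x.1.2 -> mdot (real_mx x.1.1) (real_mx x.1.1) <= Phi x &
    forall rc0 a0 rc a x0 x y (lambda : 'M[R]_n.+1),
      switch_step Dr g amax a0 rc0 x0 x -> switch_step Dr g amax a rc x y ->
      Phi y <= Phi x + (C + 2 * (mdot (real_mx x.1.1) lambda - wmax x.1.1)
               + kappa * backlog x.1.1)
             + mdot (2 *: real_mx x.1.1) (real_mx a - lambda).

(** * The Lyapunov function with compensation of the delay *)

Section Lyapunov.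
Context {R : realType} {n : nat}.
Implicit Types (x y : state n.+1) (g : R -> R).

(** [L] will be [2 * B / delta]: without reconfiguration the gap grows by at most [2 * B] in a slot,
    hence [gamma] by at most [delta], and right after a reconfiguration [gamma] is at most
    [delta]. *)
Definition gamma (L : R) x : R := Num.min 1 (gap x.1.1 x.1.2 / L).
Definition psi (Dr : nat) (L : R) x : R :=
  backlog x.1.1 * (x.2%:R + Dr%:R * gamma L x).

Definition rare_reconf g := forall L : R, exists2 K : R, 0 <= K &
  forall (q : 'M[nat]_n.+1) (s : 'M[bool]_n.+1), feasible s -> K <= wmax q ->
    g (wmax q) < gap q s -> L <= gap q s.

Lemma gamma_ge0 L x : 0 < L -> feasible x.1.2 -> 0 <= gamma L x.
Proof.
by move=> L0 fx; rewrite le_min ler01 divr_ge0 ?gap_ge0// ltW.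
Qed.

Lemma gamma_le1 L x : gamma L x <= 1.
Proof. by rewrite ge_min lexx. Qed.

Section OneStep.
Context (Dr : nat) (g : R -> R) (amax : R) (a : 'M[nat]_n.+1) (rc : bool).
Context (x y : state n.+1) (xy : switch_step Dr g amax a rc x y).
Let B : R := (n.+1 * n.+1)%:R * (amax + 1).

Lemma gamma_reconf (delta : R) : 0 < delta -> rc ->
  gamma (2 * B / delta) y <= delta.
Proof.
move=> d0 rct; have B0 := step_bound_gt0 xy.
have L0 : 0 < 2 * B / delta by rewrite divr_gt0// mulr_gt0.
rewrite ge_min ler_pdivrMr// [delta * _]mulrC divfK ?gt_eqF//.
by rewrite (step_gap_reconf xy rct) orbT.
Qed.

Lemma gamma_keep (delta : R) : 0 < delta -> ~~ rc ->
  gamma (2 * B / delta) y <= gamma (2 * B / delta) x + delta.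
Proof.
move=> d0 rct; have B0 := step_bound_gt0 xy.
have L0 : 0 < 2 * B / delta by rewrite divr_gt0// mulr_gt0.
rewrite /gamma addr_minl le_min ge_min ge_min; apply/andP; split.
  by rewrite lerDl ltW.
apply/orP; right; have dL : delta * (2 * B / delta) = 2 * B.
  by rewrite mulrC divfK ?gt_eqF.
rewrite ler_pdivrMr// [leRHS]mulrDl dL divfK ?gt_eqF//.
exact: step_gap_keep xy rct.
Qed.

(* The jump of the remaining time at a reconfiguration is compensated by the
   drop of gamma from 1 to almost 0. *)
Lemma psi_drift (delta K : R) : 0 < delta -> 0 <= K ->
  (K <= wmax x.1.1 -> rc -> 2 * B / delta <= gap x.1.1 x.1.2) ->
  psi Dr (2 * B / delta) y <= psi Dr (2 * B / delta) x
    + 2 * Dr%:R * B + n.+1%:R * K * (2 * Dr%:R + 1)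
    + Dr%:R * delta * backlog x.1.1 - (x.2 != 0)%:R * backlog x.1.1.
Proof.
move=> d0 K0 rareK; have B0 := step_bound_gt0 xy.
have L0 : 0 < 2 * B / delta by rewrite divr_gt0// mulr_gt0.
rewrite /psi; have := step_backlog xy; rewrite ler_norml => /andP[_].
have gy0 := gamma_ge0 L0 (step_feasible' xy).
have gx0 := gamma_ge0 L0 (step_feasible xy).
have gy1 := gamma_le1 (2 * B / delta) y.
have gx1 := gamma_le1 (2 * B / delta) x.
have greconf := gamma_reconf d0; have gkeep := gamma_keep d0.
have g1 : K <= wmax x.1.1 -> rc -> gamma (2 * B / delta) x = 1.
  by move=> Kx rct; apply/min_idPl; rewrite ler_pdivlMr// mul1r rareK.
have Qx0 := backlog_ge0 (R := R) x.1.1; have Qy0 := backlog_ge0 (R := R) y.1.1.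
have QK : ~~ (K <= wmax x.1.1) -> backlog x.1.1 <= n.+1%:R * K.
  rewrite -ltNge => /ltW Kx.
  by rewrite (le_trans (backlog_le_wmax _))// ler_wpM2l.
have NK0 : 0 <= n.+1%:R * K by exact: mulr_ge0.
have rE := step_remain xy.
have ry : y.2%:R <= Dr%:R :> R by rewrite ler_nat (step_remain_le xy).
have rx : x.2%:R <= Dr%:R :> R by rewrite ler_nat (step_delay xy).
have rx1 : (x.2 != 0)%:R <= x.2%:R :> R by rewrite ler_nat; case: (x.2).
have rkeep : ~~ rc -> y.2%:R = x.2%:R - (x.2 != 0)%:R :> R.
  move=> /negPf rct; rewrite rE rct; case: (x.2) => [|k] /=; first by rewrite subr0.
  by rewrite -(addn1 k) natrD addrK.
have rreconf : rc -> y.2%:R = Dr%:R :> R by move=> rct; rewrite rE rct.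
have i0 : 0 <= (x.2 != 0)%:R :> R by [].
have i1 : (x.2 != 0)%:R <= 1 :> R by rewrite lern1 leq_b1.
have Dr0 : 0 <= Dr%:R :> R by [].
have ry0 : 0 <= y.2%:R :> R by []. have rx0 : 0 <= x.2%:R :> R by [].
move: rkeep rreconf greconf gkeep g1 QK.
move: ry rx rx1 i0 i1 Dr0 ry0 rx0 gx0 gx1 gy0 gy1 Qx0 Qy0 NK0.
move: (gamma _ x) (gamma _ y) (backlog x.1.1) (backlog y.1.1) (n.+1%:R * K).
move: ((x.2 != 0)%:R) (x.2%:R) (y.2%:R) (Dr%:R) (K <= _)%R => i r r' D KW.
move=> c c' Q Q' NK ry rx rx1 i0 i1 Dr0 ry0 rx0 gx0 gx1 gy0 gy1 Qx0 Qy0 NK0.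
move=> rkeep rreconf greconf gkeep g1 QK QQ.
(* Product rule for [psi]: [T1] is the change of the backlog times the new factor, [T2] the old
   backlog times the change of the factor. *)
have T1 : (Q' - Q) * (r' + D * c') <= 2 * D * B.
  have : r' + D * c' <= 2 * D by nra.
  have : 0 <= r' + D * c' by rewrite addr_ge0// mulr_ge0.
  move: (r' + D * c') => z z0 zD.
  apply: (@le_trans _ _ (B * z)); first by rewrite ler_wpM2r.
  by rewrite mulrC ler_wpM2r// ltW.
have T2 : Q * (r' - r + D * (c' - c) + i - D * delta) <= NK * (2 * D + 1).
  (* For large weight, a reconfiguration turns [r + D] into at most [D + D * delta], and [i <= r];
     without one, the remaining time drops by exactly [i]. For small weight, [Q <= NK] and a crude
     bound on the factor suffices. *)
  have [Kx|Kx] := boolP KW.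
    suff : r' - r + D * (c' - c) + i - D * delta <= 0.
      move=> z0; apply: (@le_trans _ _ 0); last by rewrite mulr_ge0//; lra.
      by rewrite mulr_ge0_le0.
    have [rct|rct] := boolP rc.
      rewrite (rreconf rct) (g1 Kx rct); have := greconf rct.
      by move: (c') => z; nra.
    rewrite (rkeep rct); have := gkeep rct.
    by move: (c') => z; nra.
  apply: (@le_trans _ _ (Q * (2 * D + 1))).
    rewrite ler_wpM2l//.
    have : D * (c' - c) <= D * 1 by rewrite ler_wpM2l//; lra.
    have : 0 <= D * delta by rewrite mulr_ge0// ltW.
    by lra.
  by rewrite ler_wpM2r// ?QK//; lra.
by nra.
Qed.

(** Remaining time 0 excludes a reconfiguration on entering [y], which would have set it to
    [Dr > 0]. Hence the gap at [x] was at most [g] of the maximal weight, and it has grown by at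
    most [2 * B]. *)
Lemma gap_idle (delta C0 : R) : (0 < Dr)%N -> 0 < delta ->
  (forall z, 0 <= z -> g z <= delta * z + C0) -> y.2 = 0%N ->
  gap y.1.1 y.1.2 <= delta * wmax y.1.1 + (delta * B + C0 + 2 * B).
Proof.
move=> Dr0 d0 gC y0.
have nrc : ~~ rc.
  by apply/negP => rct; move: (step_remain xy); rewrite rct y0 => E; lia.
have := step_gap_keep xy nrc.
have : gap x.1.1 x.1.2 <= g (wmax x.1.1).
  by rewrite leNgt -(step_reconf xy).
have := gC (wmax x.1.1) (ler0n _ _).
have := step_wmax xy; rewrite ler_norml => /andP[h _].
have : delta * wmax x.1.1 <= delta * (wmax y.1.1 + B).
  by rewrite ler_wpM2l ?(ltW d0)//; rewrite -/B in h; lra.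
by rewrite -/B mulrDr; lra.
Qed.

End OneStep.

Lemma drift_exists g (Dr : nat) (amax kappa : R) :
  (0 < Dr)%N -> rare_reconf g ->
  (forall delta, 0 < delta -> exists C0, forall z, 0 <= z -> g z <= delta * z + C0) ->
  0 <= amax -> 0 < kappa ->
  exists C, drift_certificate n g Dr amax kappa C.
Proof.
move=> Dr0 rare subg amax0 kappa0.
have D0 : 0 <= Dr%:R :> R by [].
have D2 : 0 < 2 * (1 + Dr%:R) :> R by lra.
(* The squared norm loses [2 * delta] times the backlog through [gap_idle], and twice [psi] loses
   [2 * Dr * delta] times the backlog; the sum is [kappa]. *)
pose delta := kappa / (2 * (1 + Dr%:R)).
have d0 : 0 < delta by rewrite divr_gt0.
have kE : kappa = 2 * (1 + Dr%:R) * delta by rewrite /delta mulrC divfK ?gt_eqF.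
pose B : R := (n.+1 * n.+1)%:R * (amax + 1).
have B0 : 0 < B by rewrite mulr_gt0 ?ltr0n//; lra.
have L0 : 0 < 2 * B / delta by rewrite divr_gt0// mulr_gt0.
have [C0 gC0] := subg _ d0.
have [K K0 rareK] := rare (2 * B / delta).
have gC z : 0 <= z -> g z <= delta * z + `|C0|.
  by move=> z0; rewrite (le_trans (gC0 z z0))// lerD2l ler_norm.
pose C1 := delta * B + `|C0| + 2 * B.
have C10 : 0 <= C1 by rewrite !addr_ge0// mulr_ge0// ltW.
pose C2 := 2 * Dr%:R * B + n.+1%:R * K * (2 * Dr%:R + 1).
have C20 : 0 <= C2 by rewrite /C2 !addr_ge0// !mulr_ge0// ?ltW//; lra.
pose C3 : R := (n.+1 * n.+1)%:R * (amax ^+ 2 + 1).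
have C30 : 0 <= C3 by rewrite mulr_ge0// addr_ge0// sqr_ge0.
exists (2 * C1 + 2 * C2 + C3); split; first by lra.
exists (fun x => mdot (real_mx x.1.1) (real_mx x.1.1) + 2 * psi Dr (2 * B / delta) x).
  move=> x fx; rewrite lerDl mulr_ge0// mulr_ge0 ?backlog_ge0//.
  by rewrite addr_ge0// mulr_ge0// gamma_ge0.
move=> rc0 a0 rc a x0 x y lambda s0 s1.
have sq := step_square s1 lambda.
have rK : K <= wmax x.1.1 -> rc -> 2 * B / delta <= gap x.1.1 x.1.2.
  by move=> Kx; rewrite (step_reconf s1); exact: rareK (step_feasible s1) Kx.
have ps := psi_drift s1 d0 K0 rK.
have gx := gap_idle s0 Dr0 d0 gC.
have Wx := weight_le_backlog (R := R) x.1.1 x.1.2.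
have Wm := wmax_le_backlog (R := R) x.1.1.
have Q0 := backlog_ge0 (R := R) x.1.1.
have gapE : gap x.1.1 x.1.2 = wmax x.1.1 - (weight x.1.1 x.1.2)%:R by [].
rewrite -/B -/C1 in gx; rewrite -/B in ps.
rewrite -/C3 in sq; have C2E : C2 = 2 * Dr%:R * B + n.+1%:R * K * (2 * Dr%:R + 1) by [].
clearbody C1 C2 C3 delta.
(* During a delay the last term suffices, the maximal weight being at most the backlog; twice this
   term is cancelled by the decrease of twice [psi]. *)
have key : - ((weight x.1.1 x.1.2)%:R * (x.2 == 0)%:R) <=
    - wmax x.1.1 + delta * backlog x.1.1 + C1 + (x.2 != 0)%:R * backlog x.1.1.
  have dW : delta * wmax x.1.1 <= delta * backlog x.1.1 by rewrite ler_wpM2l// ltW.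
  have dQ : 0 <= delta * backlog x.1.1 by rewrite mulr_ge0// ltW.
  have [x20|x20] := eqVneq x.2 0%N.
    by have := gx x20; rewrite gapE mulr1 mul0r; move: dW; move: (weight _ _)%:R => W; lra.
  by rewrite mulr0 mul1r; lra.
by rewrite kE; move: key ps sq C2E; lra.
Qed.

End Lyapunov.

(** * Bounded hysteresis *)

Section Hysteresis.
Context {R : realType} (g : R -> R).
Hypothesis g_increasing : forall x y : R, 0 <= x -> x < y -> g x < g y.

Lemma increasing_le x y : 0 <= x -> x <= y -> g x <= g y.
Proof.
by move=> x0; rewrite le_eqVlt => /predU1P[->//|xy]; rewrite ltW// g_increasing.
Qed.

Lemma sublinear_bound : g x / x @[x --> +oo] --> (0 : R) ->
  forall delta, 0 < delta -> exists C0, forall z, 0 <= z -> g z <= delta * z + C0.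
Proof.
move=> g0 delta d0.
have /cvgrPdist_le/(_ delta d0) := g0.
move=> [K [_ Kg]].
pose K' := `|K| + 1.
have K'0 : 0 < K' by rewrite ltr_wpDl.
have K'K : K < K' by rewrite (le_lt_trans (ler_norm K))// ltrDl.
exists (`|g K'|) => z z0; have [zK|Kz] := leP z K'.
  rewrite (le_trans (increasing_le z0 zK))// (le_trans (ler_norm _))//.
  by rewrite lerDr mulr_ge0// ltW.
have z0' : 0 < z by exact: lt_trans Kz.
have /= := Kg z (lt_trans K'K Kz); rewrite sub0r normrN => h.
have : g z / z <= delta by exact: le_trans (ler_norm _) h.
by rewrite ler_pdivrMr// => /le_trans; apply; rewrite lerDl.
Qed.

Lemma rare_reconf_unbounded n : (forall c, exists2 x, 0 <= x & c <= g x) ->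
  @rare_reconf R n g.
Proof.
move=> ub L; have [K K0 LK] := ub L; exists K => // q s _ Kq gq.
by rewrite (le_trans LK)// (le_trans (increasing_le K0 Kq))// ltW.
Qed.

(** In the 1 by 1 switch the gap is either 0 or the whole backlog, and a nonnegative value of [g]
    forbids a reconfiguration at gap 0. *)
Lemma rare_reconf_scalar x0 : 0 <= x0 -> 0 <= g x0 -> @rare_reconf R 0 g.
Proof.
move=> x00 g0 L; exists (x0 + `|L|); first by rewrite addr_ge0.
move=> q s fs Kq gq.
have gap0 : 0 < gap q s :> R.
  apply: le_lt_trans gq; apply: le_trans g0 (increasing_le x00 _).
  by rewrite (le_trans _ Kq)// lerDl.
have Qq := wmax_le_backlog (R := R) q.
have wE : (weight q s)%:R = backlog q * (s ord0 ord0)%:R :> R.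
  by rewrite /weight /backlog !big_ord1 natrM.
move: gap0; rewrite /gap wE; case: (s ord0 ord0); last first.
  rewrite mulr0 subr0 => _; apply: le_trans (ler_norm L) _.
  by apply: le_trans Kq; rewrite lerDr.
by rewrite mulr1 subr_gt0 ltNge Qq.
Qed.

End Hysteresis.

Section SmallHysteresisStep.
Context {R : realType} {n : nat}.
Context (Dr : nat) (g : R -> R) (amax : R) (a : 'M[nat]_n.+1) (rc : bool).
Context (x y : state n.+1) (xy : switch_step Dr g amax a rc x y).
Let B : R := (n.+1 * n.+1)%:R * (amax + 1).

Definition sched_mx (s : 'M[bool]_n.+1) : 'M[R]_n.+1 := \matrix_(i, j) (s i j)%:R.

Lemma sched_sum (s : 'M[bool]_n.+1) : feasible s ->
  \sum_i \sum_j (s i j)%:R <= n.+1%:R :> R.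
Proof.
move=> /andP[_ /forallP fs].
apply: (@le_trans _ _ (\sum_(i < n.+1) 1)); last by rewrite sumr_const card_ord.
by apply: ler_sum => i _; rewrite -natr_sum lern1.
Qed.

Definition served : R := backlog x.1.1 + \sum_i \sum_j (a i j)%:R - backlog y.1.1.

Lemma served_entry i j :
  let u : R := (x.1.1 i j)%:R + (a i j)%:R - (y.1.1 i j)%:R in
  [/\ 0 <= u, u <= (x.1.2 i j)%:R * (x.2 == 0%N)%:R & u * (x.1.2 i j)%:R = u].
Proof.
rewrite /= (step_entry xy) natrM.
set q : R := (x.1.1 i j)%:R; set k : R := (a i j)%:R.
have q0 : 0 <= q by []. have k0 : 0 <= k by [].
have f0 : 0 <= (x.2 == 0%N)%:R :> R by [].
have f1 : (x.2 == 0%N)%:R <= 1 :> R by rewrite lern1 leq_b1.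
move: (x.2 == 0%N)%:R f0 f1 => f f0 f1.
case: (x.1.2 i j); rewrite ?mul1r ?mul0r ?mulr1 ?mulr0.
  by case: (leP (q + k - f) 0) => h; split; lra.
rewrite subr0; have /max_idPl -> : 0 <= q + k by rewrite addr_ge0.
by rewrite subrr.
Qed.

Lemma servedE :
  served = \sum_i \sum_j ((x.1.1 i j)%:R + (a i j)%:R - (y.1.1 i j)%:R).
Proof.
rewrite /served /backlog -big_split -sumrB; apply: eq_bigr => i _ /=.
by rewrite -big_split -sumrB; apply: eq_bigr.
Qed.

Lemma served_le : served <= n.+1%:R * (x.2 == 0%N)%:R.
Proof.
rewrite servedE.
apply: (@le_trans _ _ ((\sum_i \sum_j (x.1.2 i j)%:R) * (x.2 == 0%N)%:R)); last first.
  by rewrite ler_wpM2r// sched_sum// (step_feasible xy).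
rewrite mulr_suml; apply: ler_sum => i _; rewrite mulr_suml; apply: ler_sum => j _.
by have [] := served_entry i j.
Qed.

Lemma weight_keep : ~~ rc -> (weight y.1.1 y.1.2)%:R =
  (weight x.1.1 x.1.2)%:R + mdot (sched_mx x.1.2) (real_mx a) - served.
Proof.
move=> nrc; rewrite (step_sched xy nrc) !weightE servedE /mdot -big_split -sumrB.
apply: eq_bigr => i _ /=; rewrite -big_split -sumrB; apply: eq_bigr => j _ /=.
have [_ _ <-] := served_entry i j; rewrite !mxE; ring.
Qed.

Lemma weight_reconf_le (c : R) : gap x.1.1 x.1.2 <= c -> rc ->
  (weight y.1.1 y.1.2)%:R <= (weight x.1.1 x.1.2)%:R + c + B.
Proof.
move=> gc rct; have := step_weight xy y.1.2; rewrite ler_norml => /andP[_].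
rewrite (step_opt xy rct) -/B; move: gc; rewrite /gap /wmax.
by move: ((max_weight _)%:R) ((weight x.1.1 _)%:R) ((weight y.1.1 _)%:R) => u v w; lra.
Qed.

Lemma weight_reconf_ge : rc ->
  (weight x.1.1 x.1.2)%:R - B <= (weight y.1.1 y.1.2)%:R :> R.
Proof.
move=> rct; have := step_weight xy y.1.2; rewrite ler_norml => /andP[+ _].
rewrite (step_opt xy rct) -/B.
have := weight_le_max x.1.1 (step_feasible xy); rewrite -(ler_nat R).
by move: ((max_weight _)%:R) ((weight x.1.1 _)%:R) ((weight y.1.1 _)%:R) => u v w; lra.
Qed.

Lemma gap_bounded (c : R) : 0 <= c -> (forall z, 0 <= z -> g z <= c) ->
  gap y.1.1 y.1.2 <= c + 2 * B.
Proof.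
move=> c0 gc; have [rct|nrc] := boolP rc.
  by rewrite (le_trans (step_gap_reconf xy rct))// lerDr.
apply: le_trans (step_gap_keep xy nrc) _; rewrite lerD2r.
have := gc (wmax x.1.1) (ler0n _ _); apply: le_trans.
by rewrite leNgt -(step_reconf xy).
Qed.

End SmallHysteresisStep.

Section Instability.
Context {R : realType} {n : nat} (S : switch_process n.+1 R).
Context (Xb : random_element R (state n.+1)).
Context (Dr : nat) (g : R -> R) (nu : 'M[R]_n.+1) (eps amax : R).
Hypotheses (Dr0 : (0 < Dr)%N) (sysS : is_switch_system S Dr g).
Hypotheses (bS : bounded_arrivals S amax).
Hypotheses (meanS : mean_arrivals S ((1 - eps) *: nu)) (steadyS : steady_state S Xb).
Hypotheses (nuF : critical_rates nu) (eps0 : 0 < eps) (eps1 : eps < 1).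

Local Notation X := (@swp_state n.+1 R S).

Let B : R := (n.+1 * n.+1)%:R * (amax + 1).
Let lambda := (1 - eps) *: nu.

Lemma sum_lambda : \sum_i \sum_j lambda i j = (1 - eps) * n.+1%:R.
Proof.
have [_ nur] := nuF.
under eq_bigr do under eq_bigr do rewrite mxE.
under eq_bigr do rewrite -mulr_sumr nur.
by rewrite -mulr_sumr sumr_const card_ord.
Qed.

Lemma mdot_const1 (A : 'M[R]_n.+1) : mdot (const_mx 1) A = \sum_i \sum_j A i j.
Proof. by do 2! apply: eq_bigr => ? _; rewrite mxE mul1r. Qed.

(** The gap is nonnegative, so every slot triggers a reconfiguration, the remaining time stays at
    [Dr > 0] and nothing is served: the backlog grows at the total arrival rate. *)
Lemma unstable_negative : (forall z, 0 <= z -> g z < 0) -> False.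
Proof.
move=> gneg.
have markS : markov_switch S by case: sysS.
have measS : swp_measurable S by case: sysS.
have rct t w : swp_reconf (s := S) t.+1 w.
  have xy := system_step sysS bS t w; rewrite (step_reconf xy).
  exact: lt_le_trans (gneg _ (ler0n _ _)) (gap_ge0 _ (step_feasible xy)).
have [[w0 _]|noOmega] := pselect (exists w : swp_space S, True); last first.
  apply: (@no_steady_state _ _ S Xb lambda amax measS markS bS meanS steadyS
    (fun=> 0) (fun=> 0) 1 0) => //.
  - by exists 0 => x i j; rewrite mxE normr0.
  - by move=> t w; case: noOmega; exists w.
  - by move=> t w; case: noOmega; exists w.
have B0 := step_bound_gt0 (system_step sysS bS 0 w0).
apply: (@no_steady_state _ _ S Xb lambda amax measS markS bS meanS steadyS
  (fun x => backlog x.1.1) (fun=> const_mx 1) ((1 - eps) * n.+1%:R) B) => //.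
- by rewrite mulr_gt0// subr_gt0.
- exact: ltW.
- by move=> x; exact: backlog_ge0.
- by exists 1 => x i j; rewrite mxE normr1.
- by move=> t w _; exact: step_backlog (system_step sysS bS t w).
move=> [//|t] w _.
have xy := system_step sysS bS t.+1 w.
have r0 : (X t.+1 w).2 == 0%N = false.
  by rewrite (step_remain (system_step sysS bS t w)) rct eqn0Ngt Dr0.
have /= := served_le xy; rewrite r0 mulr0 /served subr_le0 => h.
rewrite mdot_const1 -sum_lambda.
apply: le_trans h; rewrite -addrA lerD2l -big_split/=; apply: ler_sum => i _.
by rewrite -big_split/=; apply: ler_sum => j _; rewrite !mxE addrC subrK.
Qed.

(** With at least two columns, another entry of the row takes at least [m]. *)
Lemma rates_le (m : R) : (0 < n)%N -> (forall i j, m <= nu i j) -> 0 <= m ->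
  forall i j, nu i j <= 1 - m.
Proof.
move=> n0 mnu m0 i j; have [_ nur] := nuF.
have [k kj] : exists k : 'I_n.+1, k != j.
  have [->|j0] := eqVneq j ord0; last by exists ord0; rewrite eq_sym.
  by exists ord_max; rewrite -val_eqE /= -lt0n.
rewrite lerBrDr -(nur i) (bigD1 j)//= lerD2l (bigD1 k)//=.
apply: (@le_trans _ _ (nu i k)); first exact: mnu.
by rewrite lerDl; apply: sumr_ge0 => l _; exact: le_trans (mnu i l).
Qed.

(* With a bounded hysteresis function the schedule is reconfigured at a positive
   rate, uniformly in eps, and the capacity lost in this way exceeds the slack
   eps: K * backlog - weight + C * 1_{r > 0} has a positive drift. *)
Lemma unstable_bounded (c m : R) (K := c + 3 * B + n.+1%:R + 1) :
  (0 < n)%N -> 0 < m -> (forall i j, m <= nu i j) ->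
  0 <= c -> (forall z, 0 <= z -> g z <= c) -> K * eps < m -> False.
Proof.
move=> n0 m0 mnu c0 gc epsK.
have markS : markov_switch S by case: sysS.
have measS : swp_measurable S by case: sysS.
have [[w0 _]|noOmega] := pselect (exists w : swp_space S, True); last first.
  apply: (@no_steady_state _ _ S Xb lambda amax measS markS bS meanS steadyS
    (fun=> 0) (fun=> 0) 1 0) => //.
  - by exists 0 => x i j; rewrite mxE normr0.
  - by move=> t w; case: noOmega; exists w.
  - by move=> t w; case: noOmega; exists w.
have B0 : 0 < B := step_bound_gt0 (system_step sysS bS 0 w0).
have N0 : 0 < n.+1%:R :> R by rewrite ltr0n.
have N1 : 1 <= n.+1%:R :> R by rewrite ler1n.
(* At a reconfiguration the weight rises by at most the gap, itself at most [c + 2 * B], plus [B];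
   the summand [n.+1] covers the departures subtracted in [wUp]. *)
pose C := c + 3 * B + n.+1%:R.
have C0 : 0 <= C by rewrite /C; lra.
have KC : K = C + 1 by [].
have K1 : 1 <= K by rewrite KC; lra.
have K0 : 0 <= K := le_trans ler01 K1.
have KB0 : 0 <= K * B by rewrite mulr_ge0// ltW.
pose Z (x : state n.+1) := K * backlog x.1.1 - (weight x.1.1 x.1.2)%:R + C * (x.2 != 0%N)%:R : R.
have wUp t w : (0 < t)%N -> let x := X t w in let y := X t.+1 w in
    (weight y.1.1 y.1.2)%:R - (weight x.1.1 x.1.2)%:R <=
    mdot (sched_mx x.1.2) (real_mx (swp_arr t w)) - served (swp_arr t w) x y
      + C * (swp_reconf (s := S) t.+1 w)%:R /\
    `|(weight y.1.1 y.1.2)%:R - (weight x.1.1 x.1.2)%:R| <= c + 3 * B.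
  case: t => // t _ x y.
  have s0 := system_step sysS bS t w; have s1 := system_step sysS bS t.+1 w.
  have gx := gap_bounded s0 c0 gc.
  have := served_le s1; have f1 : (x.2 == 0%N)%:R <= 1 :> R by rewrite lern1 leq_b1.
  have a0 : 0 <= mdot (sched_mx x.1.2) (real_mx (swp_arr t.+1 w)) :> R.
    by apply: mdot_ge0 => i j; rewrite mxE.
  have fN : n.+1%:R * (x.2 == 0%N)%:R <= n.+1%:R :> R by rewrite ler_piMr// ltW.
  move=> su; have [rct|nrc] := boolP (swp_reconf (s := S) t.+2 w).
    have h1 := weight_reconf_le s1 gx rct; have h2 := weight_reconf_ge s1 rct.
    rewrite -/B -/x -/y in h1 h2 su; rewrite mulr1 ler_norml /C.
    move: h1 h2 su a0 fN; move: (weight _ _)%:R (weight _ _)%:R (served _ _ _).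
    move=> u v z h1 h2 su a0 fN; split; last apply/andP; try split; lra.
  have hs : `|(weight y.1.1 y.1.2)%:R - (weight x.1.1 x.1.2)%:R| <= B.
    by rewrite /y (step_sched s1 nrc); exact: step_weight s1 _.
  split; last by apply: le_trans hs _; lra.
  by rewrite (weight_keep s1 nrc) mulr0 addr0 lerBlDl addrA.
have Rind (b : bool) : (0 <= b%:R :> R) && (b%:R <= 1 :> R).
  by rewrite ler0n lern1 leq_b1.
apply: (@no_steady_state _ _ S Xb lambda amax measS markS bS meanS steadyS
  Z (fun x => const_mx K - sched_mx x.1.2) (n.+1%:R * (m - K * eps))
  (K * B + (c + 3 * B) + C)) => //.
- by rewrite mulr_gt0// subr_gt0.
- by move: (K * B) KB0 => KB KB0; lra.
- move=> x; rewrite /Z addr_ge0 ?mulr_ge0// subr_ge0.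
  apply: le_trans (weight_le_backlog _ _) _; rewrite ler_peMl ?backlog_ge0//.
- exists (K + 1) => x i j; rewrite !mxE (le_trans (ler_normB _ _))//.
  rewrite lerD//; first by rewrite ger0_norm.
  by rewrite ger0_norm// lern1 leq_b1.
- move=> t w t0; have [_ hW] := wUp t w t0.
  have hQ := step_backlog (system_step sysS bS t w).
  have hK : `|K * (backlog (X t.+1 w).1.1 - backlog (X t w).1.1)| <= K * B.
    by rewrite normrM (ger0_norm K0) ler_wpM2l.
  have hC : `|C * (((X t.+1 w).2 != 0%N)%:R - ((X t w).2 != 0%N)%:R)| <= C.
    rewrite normrM (ger0_norm C0) ler_piMr// ler_norml.
    have := Rind ((X t.+1 w).2 != 0%N); have := Rind ((X t w).2 != 0%N).
    by move=> /andP[? ?] /andP[? ?]; apply/andP; split; lra.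
  move: hK hC hW; rewrite !ler_norml /Z => /andP[? ?] /andP[? ?] /andP[? ?].
  by apply/andP; split; lra.
move=> t w t0; have [/= hW _] := wUp t w t0.
have xy := system_step sysS bS t w.
have su := served_le xy.
have rcy : (swp_reconf (s := S) t.+1 w)%:R <= ((X t.+1 w).2 != 0%N)%:R :> R.
  rewrite (step_remain xy); case: (swp_reconf _ _) => //=.
  by rewrite -lt0n Dr0.
have f1 : ((X t w).2 != 0%N)%:R = 1 - ((X t w).2 == 0%N)%:R :> R.
  by case: (_ == _); rewrite ?subrr ?subr0.
have fs := step_feasible xy.
have mE : mdot (const_mx K - sched_mx (X t w).1.2) (real_mx (swp_arr t w) - lambda) =
    K * (\sum_i \sum_j (swp_arr t w i j)%:R) - K * ((1 - eps) * n.+1%:R)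
    - mdot (sched_mx (X t w).1.2) (real_mx (swp_arr t w))
    + mdot (sched_mx (X t w).1.2) lambda.
  rewrite -sum_lambda.
  have -> : const_mx K = K *: const_mx 1 :> 'M[R]_n.+1.
    by apply/matrixP => i j; rewrite !mxE mulr1.
  rewrite mdotBl mdotZl mdot_const1 (mdotC (sched_mx _) (_ - _)) mdotBl.
  rewrite !(mdotC _ (sched_mx _)).
  have -> : \sum_i \sum_j (real_mx (swp_arr t w) - lambda) i j =
      \sum_i \sum_j (swp_arr t w i j)%:R - \sum_i \sum_j lambda i j.
    rewrite -sumrB; apply: eq_bigr => i _; rewrite -sumrB; apply: eq_bigr => j _.
    by rewrite !mxE.
  by ring.
have sl : mdot (sched_mx (X t w).1.2) lambda <= n.+1%:R * (1 - m).
  have rl := rates_le n0 mnu (ltW m0).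
  have m1 : 0 <= 1 - m by apply: le_trans (rl ord0 ord0); exact: le_trans (ltW m0) (mnu _ _).
  apply: le_trans (ler_wpM2r m1 (sched_sum fs)).
  rewrite /mdot mulr_suml; apply: ler_sum => i _.
  rewrite mulr_suml; apply: ler_sum => j _; rewrite !mxE ler_wpM2l//.
  apply: le_trans (rl i j); rewrite ler_piMl//.
    exact: le_trans (ltW m0) (mnu _ _).
  by rewrite gerBl ltW.
have sE : served (swp_arr t w) (X t w) (X t.+1 w) = backlog (X t w).1.1 +
  \sum_i \sum_j (swp_arr t w i j)%:R - backlog (X t.+1 w).1.1 :> R by [].
rewrite /Z mE f1.
move: hW su rcy sl sE; rewrite KC.
have fb := Rind ((X t w).2 == 0%N).
move: (((X t w).2 == 0%N)%:R) fb => f /andP[f0 f1'].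
move: (served (swp_arr t w) (X t w) (X t.+1 w)) (swp_reconf _ _)%:R ((_ != 0)%:R) => u rr ry.
move: (mdot _ (real_mx _)) (mdot _ lambda) (weight (X t w).1.1 _)%:R.
move: (weight (X t.+1 w).1.1 _)%:R (backlog _) (backlog _) (\sum_i _).
clear -N0 N1 C0 f0 f1'; clearbody C; move: (n.+1%:R) N0 N1.
move=> N N0 N1 W' Q Q' A sa sl W hW su rcy hsl sE.
(* The jump of the weight at a reconfiguration is paid for by the indicator of the new delay. A
   departure costs [K] in the backlog and returns 1 in the weight, so a serving slot loses at most
   [C * N]; a delayed slot loses at most [C]. Arrivals bring [K * (1 - eps) * N] on average, less at
   most [N * (1 - m)] through the weight, so the drift is at least [N * (m - K * eps)]. *)
have : C * rr <= C * ry by rewrite ler_wpM2l.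
have : C * u <= C * (N * f) by rewrite ler_wpM2l.
have : C * (1 - f) <= C * (N * (1 - f)) by rewrite ler_wpM2l// ler_peMl// subr_ge0.
by rewrite sE in hW su *; lra.
Qed.

End Instability.

(** * Steady-state bounds *)

Lemma backlog_le_enorm {R : realType} {n} (q : 'M[nat]_n.+1) :
  backlog q <= (n.+1 * n.+1)%:R * enorm (real_mx q : 'M[R]_n.+1).
Proof.
apply: le_trans (sum_le_enorm _); apply: ler_sum => i _; apply: ler_sum => j _.
by rewrite mxE.
Qed.

Lemma enorm_le_backlog {R : realType} {n} (q : 'M[nat]_n.+1) :
  enorm (real_mx q : 'M[R]_n.+1) <= backlog q.
Proof.
apply: le_trans (enorm_le_sum _) _ => [i j|]; first by rewrite mxE.
by apply: ler_sum => i _; apply: ler_sum => j _; rewrite mxE.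
Qed.

Definition drift_bound (R : realType) n (m eps C kappa : R) (x : state n.+1) : R :=
  C - 2 * m * enorm (cone_perp (real_mx x.1.1)) - 2 * eps * m * backlog x.1.1
  + kappa * backlog x.1.1.

Lemma norm_drift_bound (R : realType) n (m eps C kappa : R) (x : state n.+1) :
  0 <= m -> 0 <= eps -> 0 <= C -> 0 <= kappa ->
  `|drift_bound m eps C kappa x| <=
  (C + 2 * m + 2 * (eps * m) + kappa) * (1 + backlog x.1.1).
Proof.
move=> m0 eps0 C0 k0; rewrite /drift_bound.
have Q0 := backlog_ge0 (R := R) x.1.1.
have := le_trans (enorm_perp_le _) (@enorm_le_backlog R n x.1.1).
have := enorm_ge0 (cone_perp (real_mx x.1.1 : 'M[R]_n.+1)).
move: (enorm _) (backlog x.1.1) Q0 => p q q0 p0 pq.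
have Cq : 0 <= C * q by rewrite mulr_ge0.
have mp : m * p <= m * q by rewrite ler_wpM2l.
have mp0 : 0 <= m * p by rewrite mulr_ge0.
have em : 0 <= eps * m by rewrite mulr_ge0.
have eq : 0 <= eps * m * q by rewrite mulr_ge0.
have kq : 0 <= kappa * q by rewrite mulr_ge0.
by rewrite ler_norml; apply/andP; split; lra.
Qed.

Section SteadyState.
Context {R : realType} {n : nat} (S : switch_process n.+1 R).
Context (Xb : random_element R (state n.+1)).
Context (Dr : nat) (g : R -> R) (nu : 'M[R]_n.+1) (eps amax m : R).
Hypothesis sysS : is_switch_system S Dr g.
Hypotheses (bS : bounded_arrivals S amax).
Hypotheses (meanS : mean_arrivals S ((1 - eps) *: nu)) (steadyS : steady_state S Xb).
Hypotheses (nuF : critical_rates nu) (eps0 : 0 < eps).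
Hypotheses (m0 : 0 < m) (mnu : forall i j, m <= nu i j).

Local Notation Pb := (re_prob Xb).
Local Notation Q := (fun w : re_space Xb => backlog (re_val w).1.1 : R).
Local Notation perp x := (enorm (cone_perp (real_mx x.1.1 : 'M[R]_n.+1))).
Local Notation par x := (enorm (cone_par (real_mx x.1.1 : 'M[R]_n.+1))).

Lemma truncated_drift (kappa C : R) : 0 < kappa ->
  drift_certificate n g Dr amax kappa C ->
  exists2 Phi : state n.+1 -> R,
    forall x, mdot (real_mx x.1.1) (real_mx x.1.1) <= Phi x &
    forall N, 0 <= \int[Pb]_w (if Phi (re_val w) <= N then
      drift_bound m eps C kappa (re_val w) else 0).
Proof.
move=> k0 [C0 [Phi0 sqPhi0 drift]].
(* The certificate controls [Phi0] on feasible schedules only, and the limit variable is not known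
   to be feasible; elsewhere the squared norm is used instead. *)
pose Phi (x : state n.+1) :=
  if feasible x.1.2 then Phi0 x else mdot (real_mx x.1.1) (real_mx x.1.1).
have sqPhi x : mdot (real_mx x.1.1) (real_mx x.1.1) <= Phi x.
  by rewrite /Phi; case: ifP => // /sqPhi0.
exists Phi => // N.
have markS : markov_switch S by case: sysS.
have measS : swp_measurable S by case: sysS.
have norm_le x : Phi x <= N -> enorm (real_mx x.1.1 : 'M[R]_n.+1) <= N + 1.
  move=> PN; have := le_trans (sqPhi x) PN; rewrite -enorm_sq.
  have := enorm_ge0 (real_mx x.1.1 : 'M[R]_n.+1); move: (enorm _) => e; nra.
apply: (@lyapunov_drift _ _ S Xb _ amax measS markS bS meanS steadyS Phi
  (drift_bound m eps C kappa)
  (fun x => 2 *: real_mx x.1.1)).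
- by move=> x; exact: le_trans (mdotAA_ge0 _) (sqPhi x).
- exists ((C + 2 * m + 2 * (eps * m) + kappa) * (1 + (n.+1 * n.+1)%:R * (N + 1))).
  move=> x /norm_le eN.
  rewrite (le_trans (norm_drift_bound _ (ltW m0) (ltW eps0) C0 (ltW k0)))// ler_wpM2l//.
    by rewrite !addr_ge0// ?mulr_ge0// ltW// mulr_gt0.
  by rewrite lerD2l (le_trans (backlog_le_enorm _))// ler_wpM2l.
- exists (2 * (N + 1)) => x i j /norm_le eN.
  rewrite mxE normrM ger0_norm// ler_wpM2l//.
  exact: le_trans (entry_le_enorm _ _ _) eN.
(* Slot 0 is left out: the certificate needs a step leading into the current state. *)
move=> [//|t] w _.
have s0 := system_step sysS bS t w; have s1 := system_step sysS bS t.+1 w.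
have := drift _ _ _ _ _ _ _ ((1 - eps) *: nu) s0 s1.
rewrite /Phi (step_feasible s1) (step_feasible' s1) => h; apply: le_trans h _.
rewrite lerD2r lerD2l /drift_bound; set x := swp_state t.+1 w.
rewrite mdotZr.
have Wp := max_weight_ge_perp x.1.1 nuF (ltW m0) mnu.
have nuQ : m * backlog x.1.1 <= mdot (real_mx x.1.1) nu.
  rewrite /backlog /mdot mulr_sumr; apply: ler_sum => i _.
  rewrite mulr_sumr; apply: ler_sum => j _.
  by rewrite mxE mulrC ler_wpM2l.
have : eps * (m * backlog x.1.1) <= eps * mdot (real_mx x.1.1) nu.
  by rewrite ler_wpM2l// ltW.
move: Wp; rewrite -/(wmax _); move: (mdot _ nu) (wmax _) (perp x) (backlog _).
by move=> a b c d; lra.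
Qed.

Lemma bounded_rv_truncated (Phi F : state n.+1 -> R) (N K : R) :
  (forall x, mdot (real_mx x.1.1) (real_mx x.1.1) <= Phi x) -> 0 <= K ->
  (forall x, `|F x| <= K * (1 + backlog x.1.1)) ->
  bounded_rv (fun w : re_space Xb => if Phi (re_val w) <= N then F (re_val w) else 0).
Proof.
move=> sqPhi K0 FK.
pose H x := if Phi x <= N then F x else 0.
have NN : 0 <= (n.+1 * n.+1)%:R :> R by [].
apply: (@bounded_rv_comp _ _ _ _ (@re_val _ _ Xb) H
  (K * (1 + (n.+1 * n.+1)%:R * (`|N| + 1)))); first exact: re_meas.
move=> w; rewrite /H; case: ifP => PN; last first.
  by rewrite normr0 mulr_ge0// addr_ge0// mulr_ge0// addr_ge0.
rewrite (le_trans (FK _))// ler_wpM2l// lerD2l.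
rewrite (le_trans (backlog_le_enorm _))// ler_wpM2l//.
have := le_trans (sqPhi (re_val w)) PN; rewrite -enorm_sq.
have := ler_norm N.
have := enorm_ge0 (real_mx (re_val w).1.1 : 'M[R]_n.+1); move: (enorm _) => e.
by move: `|N| => N'; nra.
Qed.

Lemma measurable_steady (F : state n.+1 -> R) :
  measurable_fun setT (fun w : re_space Xb => F (re_val w)).
Proof. exact: (discrete_rv_comp F (@re_meas _ _ Xb)). Qed.

(** With [kappa = eps * m], half of the term [2 * eps * m * backlog] survives and bounds every
    truncated mean by [C / (eps * m)]. *)
Lemma integrable_steady_backlog (C : R) :
  drift_certificate n g Dr amax (eps * m) C -> Pb.-integrable setT (EFin \o Q).
Proof.
have em0 : 0 < eps * m by rewrite mulr_gt0.
move=> cert; have [C0 _] := cert.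
have [Phi sqPhi drift] := truncated_drift em0 cert.
apply: (@integrable_truncations _ _ _ Pb Q (fun w => Phi (re_val w)) (C / (eps * m))).
- exact: (measurable_steady (fun x => backlog x.1.1)).
- exact: measurable_steady.
- by move=> w; exact: backlog_ge0.
move=> k; have bQ := @bounded_rv_truncated Phi (fun x => backlog x.1.1) k%:R 1 sqPhi ler01.
have {}bQ : bounded_rv (fun w : re_space Xb =>
    if Phi (re_val w) <= k%:R then backlog (re_val w).1.1 else 0 : R).
  by apply: bQ => x; rewrite ger0_norm ?backlog_ge0// mul1r lerDr.
split=> //; rewrite ler_pdivlMr// mulrC -RintegralZl//; last exact: bounded_rv_integrable.
have := drift k%:R.
set I := Rintegral _ _ _ => I0.
suff : \int[Pb]_w (eps * m * (if Phi (re_val w) <= k%:R then Q w else 0)) <= C - I.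
  by lra.
have bD : bounded_rv (fun w : re_space Xb => if Phi (re_val w) <= k%:R
    then drift_bound m eps C (eps * m) (re_val w) else 0 : R).
  apply: (bounded_rv_truncated _ sqPhi _
    (fun x => norm_drift_bound x (ltW m0) (ltW eps0) C0 (ltW em0))).
  by rewrite !addr_ge0// ?mulr_ge0// ltW.
rewrite /I -[X in X - _](Rintegral_prob_cst Pb) -RintegralB//; last 2 first.
- exact/bounded_rv_integrable/bounded_rv_cst.
- exact: bounded_rv_integrable.
apply: le_Rintegral => //.
- apply: bounded_rv_integrable; apply: bounded_rvM => //; exact: bounded_rv_cst.
- apply: bounded_rv_integrable; apply: bounded_rvB => //; exact: bounded_rv_cst.
move=> w _; case: ifP => _; last by rewrite mulr0 subr0.
have p0 : 0 <= m * perp (re_val w) by rewrite mulr_ge0 ?enorm_ge0// ltW.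
by rewrite /drift_bound; lra.
Qed.

Local Notation V theta :=
  (fun w : re_space Xb => perp (re_val w) - theta * par (re_val w)).

Lemma norm_V_le theta (x : state n.+1) : 0 < theta < 2^-1 ->
  `|perp x - theta * par x| <= 2 * backlog x.1.1.
Proof.
move=> /andP[t0 t1].
have pQ := le_trans (enorm_perp_le _) (@enorm_le_backlog R n x.1.1).
have qQ := le_trans (enorm_par_le _) (@enorm_le_backlog R n x.1.1).
have p0 := enorm_ge0 (cone_perp (real_mx x.1.1 : 'M[R]_n.+1)).
have q0 := enorm_ge0 (cone_par (real_mx x.1.1 : 'M[R]_n.+1)).
have tq : theta * par x <= 1 * par x by rewrite ler_wpM2r//; lra.
have tq0 : 0 <= theta * par x by rewrite mulr_ge0// ltW.
by rewrite ler_norml; apply/andP; split; lra.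
Qed.

Lemma integrable_V theta : 0 < theta < 2^-1 ->
  Pb.-integrable setT (EFin \o Q) -> Pb.-integrable setT (EFin \o V theta).
Proof.
move=> t01 iQ.
have i2Q : Pb.-integrable setT (fun w => 2%:E * (EFin \o Q) w)%E.
  exact: integrableZl.
apply: (le_integrable measurableT _ _ i2Q).
  apply/measurable_EFinP.
  exact: (measurable_steady (fun x => perp x - theta * par x)).
move=> w _; rewrite /= lee_fin.
apply: le_trans (norm_V_le _ t01) (ler_norm _).
Qed.

(** The pointwise inequality behind this is that [m * V] plus the drift bound is at most [C], by the
    choice of [kappa]. The truncation is removed by dominated convergence, with the integrable [V]
    as its own majorant. *)
Lemma expectation_V_le theta C : 0 < theta < 2^-1 ->
  Pb.-integrable setT (EFin \o Q) ->
  drift_certificate n g Dr amax (m * theta / (n.+1 * n.+1)%:R) C ->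
  \int[Pb]_w V theta w <= C / m.
Proof.
move=> t01 iQ cert; have [t0 t1] := andP t01; have [C0 _] := cert.
have NN : 0 < (n.+1 * n.+1)%:R :> R by rewrite ltr0n.
have k0 : 0 < m * theta / (n.+1 * n.+1)%:R by rewrite divr_gt0// mulr_gt0.
have [Phi sqPhi drift] := truncated_drift k0 cert.
have iV := integrable_V t01 iQ.
pose f (k : nat) (w : re_space Xb) : R :=
  if Phi (re_val w) <= k%:R then V theta w else 0.
have cf : \int[Pb]_w f k w @[k --> \oo] --> \int[Pb]_w V theta w.
  apply: (@cvg_Rintegral_dominated _ _ _ _ _ _ (fun w => `|V theta w|)).
  - move=> k; exact: (measurable_steady
      (fun x => if Phi x <= k%:R then perp x - theta * par x else 0)).
  - exact: (measurable_steady (fun x => perp x - theta * par x)).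
  - exact: integrable_norm.
  - by move=> k w; rewrite /f; case: ifP => _ //; rewrite normr0.
  move=> w; exists (Num.truncn `|Phi (re_val w)|).+1 => k; rewrite -(ler_nat R) => kP.
  rewrite /f ifT// (le_trans (ler_norm _))// (le_trans _ kP)// ltW//.
  exact: truncnS_gt.
apply: (cvgr_to_le cf); near=> k.
have bf : bounded_rv (f k).
  have K0 : 0 <= 2 :> R by [].
  apply: (@bounded_rv_truncated Phi (fun x => perp x - theta * par x) _ 2 sqPhi K0) => x.
  rewrite (le_trans (norm_V_le x t01))// ler_wpM2l// lerDr//.
have bD : bounded_rv (fun w : re_space Xb => if Phi (re_val w) <= k%:R
    then drift_bound m eps C (m * theta / (n.+1 * n.+1)%:R) (re_val w) else 0 : R).
  apply: (bounded_rv_truncated _ sqPhi _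
    (fun x => norm_drift_bound x (ltW m0) (ltW eps0) C0 (ltW k0))).
  by rewrite !addr_ge0// ?mulr_ge0// ltW// mulr_gt0.
rewrite ler_pdivlMr// mulrC -RintegralZl//; last exact: bounded_rv_integrable.
have := drift k%:R.
set I := Rintegral _ _ _ => I0.
suff : \int[Pb]_w (m * f k w) <= C - I by lra.
rewrite /I -[X in X - _](Rintegral_prob_cst Pb) -RintegralB//; last 2 first.
- exact/bounded_rv_integrable/bounded_rv_cst.
- exact: bounded_rv_integrable.
apply: le_Rintegral => //.
- apply: bounded_rv_integrable; apply: bounded_rvM => //; exact: bounded_rv_cst.
- apply: bounded_rv_integrable; apply: bounded_rvB => //; exact: bounded_rv_cst.
move=> w _; rewrite /f; case: ifP => _; last by rewrite mulr0 subr0.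
rewrite /drift_bound; set x := re_val w.
have kQ : m * theta / (n.+1 * n.+1)%:R * backlog x.1.1 <=
    m * theta * (perp x + par x).
  rewrite -mulrA ler_wpM2l//; first by rewrite mulr_ge0// ltW.
  rewrite mulrC ler_pdivrMr// mulrC (le_trans (backlog_le_enorm _))//.
  by rewrite ler_wpM2l// enorm_le_perp_par.
have p0 := enorm_ge0 (cone_perp (real_mx x.1.1 : 'M[R]_n.+1)).
have q0 := enorm_ge0 (cone_par (real_mx x.1.1 : 'M[R]_n.+1)).
have mp0 : 0 <= m * perp x by rewrite mulr_ge0// ltW.
have mtp : theta * (m * perp x) <= 1 * (m * perp x) by rewrite ler_wpM2r//; lra.
have eQ : 0 <= eps * m * backlog x.1.1.
  by rewrite mulr_ge0 ?backlog_ge0// mulr_ge0// ltW.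
by move: kQ; move: (m * theta / _) => kappa kQ; lra.
Unshelve. all: by end_near. Qed.

End SteadyState.

(** * Uniformity over the family of systems *)

Lemma min_entry_le (R : realType) n (A : 'M[R]_n.+1) i j : min_entry A <= A i j.
Proof.
by apply: (bigmin_inf i) => //; exact: bigmin_le.
Qed.

Lemma arrival_bound_ge0 (R : realType) n (S : switch_process n.+1 R) (amax : R) :
  bounded_arrivals S amax -> 0 <= amax.
Proof.
move=> bS; have [[w _]|none] := pselect (exists w : swp_space S, True).
  exact: le_trans (bS 0%N w ord0 ord0).
have : swp_prob S [set: swp_space S] = 1%E by exact: probability_setT.
rewrite (_ : [set: _] = set0) ?measure0; last first.
  by apply/seteqP; split=> // w _; apply: none; exists w.
by move=> /eqP; rewrite eq_sym onee_eq0.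
Qed.

(** The property concerns [g] and the size alone, so any member of the family may be used to refute
    its failure: parameter 1/2 for the 1 by 1 switch with negative [g], a small parameter for a
    larger switch with bounded [g]. *)
Lemma stable_rare_reconf (R : realType) n (Dr : nat) (g : R -> R) (amax : R)
    (nu : 'M[R]_n.+1) (S : R -> switch_process n.+1 R)
    (Xb : R -> random_element R (state n.+1)) :
  (0 < Dr)%N -> (forall x y : R, 0 <= x -> x < y -> g x < g y) ->
  critical_rates nu -> 0 < min_entry nu -> 0 <= amax ->
  (forall eps, 0 < eps < 1 -> [/\ is_switch_system (S eps) Dr g,
    bounded_arrivals (S eps) amax, mean_arrivals (S eps) ((1 - eps) *: nu) &
    steady_state (S eps) (Xb eps)]) ->
  @rare_reconf R n g.
Proof.
move=> Dr0 ginc nuF m0 amax0 sys.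
have [ub|] := pselect (forall c, exists2 x, 0 <= x & c <= g x).
  exact: rare_reconf_unbounded.
move=> /existsNP[c0 /forall2NP bd].
pose c := `|c0|.
have gc z : 0 <= z -> g z <= c.
  move=> z0; case: (bd z) => [//|/negP]; rewrite -ltNge => /ltW h.
  by rewrite (le_trans h)// ler_norm.
have [n0|n0] := posnP n.
  subst n.
  have [[x0 x00 gx0]|neg] := pselect (exists2 x0, 0 <= x0 & 0 <= g x0).
    exact: rare_reconf_scalar gx0.
  have e0 : 0 < (2^-1 : R) < 1 by apply/andP; split; lra.
  have [s1 s2 s3 s4] := sys _ e0; have [h0 h1] := andP e0.
  exfalso; apply: (unstable_negative Dr0 s1 s2 s3 s4 nuF h1) => z z0.
  by rewrite ltNge; apply/negP => gz; apply: neg; exists z.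
pose m := min_entry nu; have mnu := min_entry_le nu.
pose K := c + 3 * ((n.+1 * n.+1)%:R * (amax + 1)) + n.+1%:R + 1.
have K1 : 1 <= K.
  have B0 : 0 <= (n.+1 * n.+1)%:R * (amax + 1) by rewrite mulr_ge0// addr_ge0.
  have N0 : 0 <= n.+1%:R :> R by [].
  have c1 : 0 <= c by exact: normr_ge0.
  by move: B0; rewrite /K; move: (_ * (amax + 1)) => B B0; lra.
have m1 : m <= 1.
  have [_ nur] := nuF; rewrite -(nur ord0) (bigD1 ord0)//= ler_wpDr ?mnu//.
  by apply: sumr_ge0 => j _; exact: le_trans (ltW m0) (mnu _ _).
have K0 : 0 < K by exact: lt_le_trans K1.
have K2 : 0 < 2 * K by rewrite mulr_gt0.
(* This parameter gives [K * eps = m / 2 < m], and it is below 1 because [m <= 1 <= K]. *)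
have e0 : 0 < m / (2 * K) < 1.
  by rewrite divr_gt0//= ltr_pdivrMr// mul1r; lra.
have [s1 s2 s3 s4] := sys _ e0; have [h0 h1] := andP e0.
exfalso; apply: (unstable_bounded Dr0 s1 s2 s3 s4 nuF h0 n0 m0 mnu _ gc).
  exact: normr_ge0.
rewrite -/K mulrCA invfM (mulrCA K) divff ?gt_eqF// mulr1.
by rewrite -/m; rewrite /m in m0 *; lra.
Qed.

Theorem theorem1 (R : realType) (n : nat) (Dr : nat) (g : R -> R)
  (Dr_gt0 : (0 < Dr)%N)
  (g_increasing : forall x y : R, 0 <= x -> x < y -> g x < g y)
  (g_sublinear : g x / x @[x --> +oo] --> (0 : R))
  (g_concave : convex_function (`[0, +oo[%classic : set R^o) (fun x => - g x)) :
  exists M : R -> R -> R -> R -> R,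
  forall (nu : 'M[R]_n.+1) (amax sigma_tilde : R)
    (S : R -> switch_process n.+1 R)
    (sigma : R -> 'M[R]_n.+1)
    (Xbar : R -> random_element R (state n.+1)),
  critical_rates nu ->
  0 < min_entry nu ->
  (forall eps : R, 0 < eps < 1 ->
     is_switch_system (S eps) Dr g /\
     iid_arrivals (S eps) /\
     bounded_arrivals (S eps) amax /\
     mean_arrivals (S eps) ((1 - eps) *: nu) /\
     std_arrivals (S eps) (sigma eps) /\
     enorm (sigma eps) ^+ 2 <= sigma_tilde ^+ 2 /\
     steady_state (S eps) (Xbar eps)) ->
  forall theta eps : R,
  0 < theta < 2^-1 ->
  0 < eps <= min_entry nu / (4 * enorm nu) ->
  let V := fun w : re_space (Xbar eps) =>
    enorm (cone_perp (steady_queue w)) - theta * enorm (cone_par (steady_queue w)) in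
  (re_prob (Xbar eps)).-integrable setT (EFin \o V) /\
  ('E_(re_prob (Xbar eps))[V] <= (M theta sigma_tilde amax (min_entry nu))%:E)%E.
Proof.
pose cert amax kappa C := drift_certificate n g Dr amax kappa C.
exists (fun theta _ amax m =>
  xget 0 [set C | cert amax (m * theta / (n.+1 * n.+1)%:R) C] / m).
move=> nu amax sigma_tilde S sigma Xbar nuF m0 sys theta eps t01 /andP[eps0 epsm] V.
have mnu := min_entry_le nu.
have eps1 : eps < 1.
  apply: le_lt_trans epsm _.
  have m_nu : min_entry nu <= enorm nu.
    rewrite (le_trans (mnu ord0 ord0))// (le_trans (ler_norm _))//.
    exact: entry_le_enorm.
  have nu0 : 0 < enorm nu by exact: lt_le_trans m_nu.
  by rewrite ltr_pdivrMr ?mulr_gt0// mul1r; lra.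
have e01 : 0 < eps < 1 by rewrite eps0.
have [sysS [_ [bS [meanS [_ [_ steadyS]]]]]] := sys _ e01.
have amax0 := arrival_bound_ge0 bS.
have rare : @rare_reconf R n g.
  apply: (@stable_rare_reconf _ _ Dr g amax nu S Xbar) => // e e0.
  by have [? [_ [? [? [_ [_ ?]]]]]] := sys _ e0.
have cert_exists kappa : 0 < kappa -> exists C, cert amax kappa C.
  exact: drift_exists Dr_gt0 rare
    (sublinear_bound g_increasing g_sublinear) amax0.
(* This constant depends on [eps] and serves only to establish integrability. *)
have [C1 cert1] := cert_exists _ (mulr_gt0 eps0 m0).
have iQ := integrable_steady_backlog sysS bS meanS steadyS nuF eps0 m0 mnu cert1.
split; first exact: integrable_V t01 iQ.
have theta0 : 0 < theta by case/andP: t01.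
have [C2 cert2] : exists C, cert amax (min_entry nu * theta / (n.+1 * n.+1)%:R) C.
  by apply: cert_exists; rewrite divr_gt0 ?mulr_gt0// ltr0n.
have {}cert2 := xgetI 0 cert2.
have := expectation_V_le sysS bS meanS steadyS nuF eps0 m0 mnu t01 iQ cert2.
rewrite -lee_fin unlock /Rintegral fineK; first exact.
exact/integrable_fin_num/(integrable_V t01 iQ).
Qed.
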